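(* For any constant $\epsilon$ of the form $\frac{1}{4c}$ with $c>0$ an even integer, there is an efficiently samplable distribution on $n$-vertex Max-Bisection instances such that, with high probability over the choice of instance: (i) there is a degree-$\Omega(n)$ SOS solution with objective value $\frac34-\epsilon$, in which the bisection identity and the objective value identity are satisfied exactly with pseudovariance zero; and (ii) every genuine bisection has objective value at most $\frac{11}{16}+\epsilon$. In particular, degree-$o(n)$ SOS does not deliver a factor-$(\frac{11}{12}+\epsilon)$ approximation for Max-Bisection.
   Context: Max-Bisection: given a (multi)graph on $n$ vertices ($n$ even), find a partition of the vertices into two halves of size $n/2$ maximizing the fraction of edges cut. SOS formulation: a $\pm1$-valued indeterminate $u_v$ per vertex, the bisection identity $\sum_v u_v=0$, and objective polynomial $\frac{1}{|E|}\sum_{\{a,b\}\in E}\frac{(u_a-u_b)^2}{4}$. A degree-$d$ SOS solution is a degree-$d$ pseudoexpectation $\widetilde{\mathbb{E}}$ (linear functional on polynomials of degree $\le d$, respecting $u_v^2=1$, $\widetilde{\mathbb{E}}[1]=1$, $\widetilde{\mathbb{E}}[Q^2]\ge0$ for $\deg Q\le d/2$); its objective value is $\widetilde{\mathbb{E}}$ of the objective polynomial; the objective value identity is ''objective $=$ that value''; an identity $Q=b$ holds with pseudovariance zero if $\widetilde{\mathbb{E}}[Q]=b$ and $\widetilde{\mathbb{E}}[Q^2]=b^2$. *)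

(* Defs.v *)
From mathcomp Require Import all_boot all_order all_algebra.
From mathcomp Require Import mpoly.
From mathcomp Require Import boolp classical_sets reals constructive_ereal ereal.
From mathcomp Require Import topology normedtype sequences.

Set Implicit Arguments.
Unset Strict Implicit.
Unset Printing Implicit Defensive.

Import Order.TTheory GRing.Theory Num.Theory numFieldNormedType.Exports.
Local Open Scope classical_set_scope.
Local Open Scope ring_scope.

(* A loopless multigraph on 'I_n: the list may repeat an edge, and the order
   inside a pair is irrelevant. *)
Record instance (n : nat) := Instance {
  edges : seq ('I_n * 'I_n);
  edges_loopless : all (fun e => e.1 != e.2) edges }.

Definition bisection n (S : {set 'I_n}) : bool := #|S| == #|~: S|.

Definition cut_fraction (R : realType) n (G : instance n) (S : {set 'I_n}) : R :=
  (count (fun e => (e.1 \in S) != (e.2 \in S)) (edges G))%:R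
  / (size (edges G))%:R.

Definition maxbis_opt (R : realType) n (G : instance n) : R :=
  \big[Num.max/0]_(S : {set 'I_n} | bisection S) cut_fraction R G S.

Definition bisection_poly (R : realType) n : {mpoly R[n]} := \sum_(v < n) 'X_v.

Definition objective_poly (R : realType) n (G : instance n) : {mpoly R[n]} :=
  (size (edges G))%:R^-1 *:
    \sum_(e <- edges G) 4%:R^-1 *: ('X_(e.1) - 'X_(e.2)) ^+ 2.

Definition total_degree (R : realType) n (p : {mpoly R[n]}) : nat := (msize p).-1.

(* Only the values of E on polynomials of degree at most d are constrained;
   its values elsewhere are irrelevant. *)
Definition pseudoexpectation (R : realType) n (d : nat)
    (E : {mpoly R[n]} -> R) : Prop :=
  [/\ forall (a : R) (p q : {mpoly R[n]}),
        (total_degree p <= d)%N -> (total_degree q <= d)%N ->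
        E (a *: p + q) = a * E p + E q,
      E 1 = 1,
      forall (v : 'I_n) (q : {mpoly R[n]}),
        (total_degree q + 2 <= d)%N -> E ('X_v ^+ 2 * q) = E q
    & forall q : {mpoly R[n]}, (2 * total_degree q <= d)%N -> 0 <= E (q ^+ 2)].

Definition zero_pseudovariance (R : realType) n (E : {mpoly R[n]} -> R)
    (Q : {mpoly R[n]}) (b : R) : Prop :=
  E Q = b /\ E (Q ^+ 2) = b ^+ 2.

Definition sos_feasible (R : realType) n (d : nat) (E : {mpoly R[n]} -> R) : Prop :=
  pseudoexpectation d E /\ zero_pseudovariance E (bisection_poly R n) 0.

Definition sos_solution (R : realType) n (d : nat) (G : instance n) (beta : R)
    (E : {mpoly R[n]} -> R) : Prop :=
  sos_feasible d E /\ zero_pseudovariance E (objective_poly R G) beta.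

Definition sos_opt (R : realType) n (d : nat) (G : instance n) : \bar R :=
  ereal_sup [set (E (objective_poly R G))%:E | E in @sos_feasible R n d].

Definition sos_delivers_factor (R : realType) (n d : nat) (alpha : R) : Prop :=
  forall G : instance n, (alpha%:E * sos_opt R d G <= (maxbis_opt R G)%:E)%E.

(* A probabilistic RAM with unit-cost addition and truncated subtraction (no
   multiplication, so that unit cost is polynomially equivalent to Turing
   machine time).  Conditionals and loops test for being nonzero. *)
Inductive expr :=
| Const of nat
| Read of expr
| Plus of expr & expr
| Minus of expr & expr.

Inductive cmd :=
| Skip
| Store of expr & expr
| Flip of expr
| Emit of expr & expr
| Then of cmd & cmd
| If of expr & cmd & cmd
| While of expr & cmd.

Record config := Config {
  memory : nat -> nat;
  coin_tape : seq bool;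
  emitted : seq (nat * nat) }.

Definition update (m : nat -> nat) (a v : nat) : nat -> nat :=
  fun x => if x == a then v else m x.

Fixpoint eval (m : nat -> nat) (e : expr) : nat :=
  match e with
  | Const k => k
  | Read e1 => m (eval m e1)
  | Plus e1 e2 => (eval m e1 + eval m e2)%N
  | Minus e1 e2 => (eval m e1 - eval m e2)%N
  end.

(* [exec c s t s'] : from s, c halts in s' after t steps.  Evaluating an
   expression costs O(1), as a program contains finitely many expressions.
   [Flip] is stuck on an exhausted coin tape. *)
Inductive exec : cmd -> config -> nat -> config -> Prop :=
| ExecSkip s : exec Skip s 1 s
| ExecStore a e m r o :
    exec (Store a e) (Config m r o) 1
         (Config (update m (eval m a) (eval m e)) r o)
| ExecFlip a m b r o :
    exec (Flip a) (Config m (b :: r) o) 1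
         (Config (update m (eval m a) (nat_of_bool b)) r o)
| ExecEmit e1 e2 m r o :
    exec (Emit e1 e2) (Config m r o) 1
         (Config m r (rcons o (eval m e1, eval m e2)))
| ExecThen c1 c2 s1 s2 s3 t1 t2 :
    exec c1 s1 t1 s2 -> exec c2 s2 t2 s3 ->
    exec (Then c1 c2) s1 (t1 + t2) s3
| ExecIfTrue e c1 c2 s1 s2 t :
    eval (memory s1) e != 0%N -> exec c1 s1 t s2 ->
    exec (If e c1 c2) s1 t.+1 s2
| ExecIfFalse e c1 c2 s1 s2 t :
    eval (memory s1) e = 0%N -> exec c2 s1 t s2 ->
    exec (If e c1 c2) s1 t.+1 s2
| ExecWhileTrue e c s1 s2 s3 t1 t2 :
    eval (memory s1) e != 0%N -> exec c s1 t1 s2 ->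
    exec (While e c) s2 t2 s3 ->
    exec (While e c) s1 (t1 + t2).+1 s3
| ExecWhileFalse e c s :
    eval (memory s) e = 0%N -> exec (While e c) s 1 s.

Definition initial_config (n : nat) (r : seq bool) : config :=
  Config (fun x => if x == 0%N then n else 0%N) r [::].

(* For each n, the law of [draw n r] for r uniform among the sequences of
   [coins n] fair coins. *)
Record instance_distribution := InstanceDistribution {
  coins : nat -> nat;
  draw : forall n, (coins n).-tuple bool -> instance n }.

(* One program, in time polynomial in n, for all even n and all coin outcomes. *)
Definition efficiently_samplable (D : instance_distribution) : Prop :=
  exists (c : cmd) (k : nat), forall n, ~~ odd n ->
  forall r : (coins D n).-tuple bool, exists (t : nat) (s : config),
    [/\ (t <= n ^ k + k)%N,
        exec c (initial_config n r) t s
      & emitted s = [seq (val e.1, val e.2) | e <- edges (draw r)]].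

Definition prob (R : realType) (D : instance_distribution) (n : nat)
    (P : instance n -> Prop) : R :=
  #|[pred r : (coins D n).-tuple bool | `[< P (draw r) >]]|%:R / 2%:R ^+ coins D n.

Definition with_high_probability (R : realType) (D : instance_distribution)
    (P : forall n, instance n -> Prop) : Prop :=
  prob R D (P n) @[n --> within [set n | ~~ odd n] \oo] --> (1 : R).

Definition big_Omega_n (R : realType) (d : nat -> nat) : Prop :=
  exists2 delta : R, 0 < delta &
    \forall n \near \oo, delta * n%:R <= (d n)%:R.

Definition little_o_n (R : realType) (d : nat -> nat) : Prop :=
  (d n)%:R / n%:R @[n --> \oo] --> (0 : R).

(* Main.v *)
Require Import Defs.
From mathcomp Require Import all_boot all_order all_algebra.
From mathcomp Require Import mpoly.
From mathcomp Require Import boolp classical_sets reals constructive_ereal ereal.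
From mathcomp Require Import topology normedtype sequences exp.
From mathcomp Require Import fintype finset.
From mathcomp Require Import zify ring lra.

Set Implicit Arguments.
Unset Strict Implicit.
Unset Printing Implicit Defensive.

Import Defs Order.TTheory GRing.Theory Num.Theory numFieldNormedType.Exports.
Local Open Scope ring_scope.

(* The variables are those of a random system of 4-XOR constraints
   x_1 x_2 x_3 x_4 = -1 on literals, written as a graph: each literal becomes a
   cloud of K vertices, each constraint an auxiliary vertex joined to the four
   clouds of its literals.  Everything is doubled by an involution w -> -w that
   negates literals and auxiliary vertices.

   SOS: by expansion the XOR system has a linear-degree pseudo-expectation
   (Grigoriev).  Giving the auxiliary vertex the value -(x_1 + x_2 + x_3 + x_4)/2,
   which squares to 1 modulo the constraint, cuts exactly 3/4 of its edges.  The
   values of w and -w add up to 0, so the bisection identity holds identically.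

   Genuine bisections: the best auxiliary value cuts 1/2 + |y_1 + ... + y_4|/8 of
   the edges, where the y_i in [-1, 1] are cloud averages.  The multilinear upper
   bound of |y_1 + ... + y_4| is 3/2 + (e_2 - e_4)/2.  The constraints are dense, so
   averaging over them replaces each y_i by the mean mu_i of its block of literals
   up to a small discrepancy, and e_2(mu) - e_4(mu) <= (mu_1 + ... + mu_4)^2 / 2.
   Since the clouds carry almost all vertices, balance forces the mu_i to sum
   to nearly 0, which leaves 1/2 + 3/16 = 11/16. *)

(** * Fourier analysis on the cube *)

(** The constants come from four signs: |x_1 + ... + x_4| is 2 when their product is -1, whence 1/2
    + 2/8 = 3/4, and has mean 3/2 over all 16 patterns, whence 11/16. A genuine cut need not give
    opposite signs to w and -w. So the two literals of a variable are treated as unrelated and the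
    y_i as arbitrary functions of literals; making all of them 1 and all auxiliary vertices -1 would
    cut every gadget edge, and balance alone excludes this. Each position in a constraint has its
    own block of N variables. Hence scopes have exactly 4 elements, and the expectation of a product
    over positions is the product of the block means. The number of constraints is a large constant
    multiple of N: the discrepancy bound must survive a union over the 2^(8N) signings of the
    literals, while expansion up to linear size holds with probability 1 - O(1/N) at any constant
    density. N is a power of 2, so that fair coins give exactly uniform literals. *)

Section Cube.
Variables (R : realFieldType) (V : finType).
Implicit Types (A B : {set V}) (x : {ffun V -> bool}).

Definition symdiff (I : finType) (A B : {set I}) : {set I} :=
  [set v | (v \in A) (+) (v \in B)].

Lemma symdiffC (I : finType) (A B : {set I}) : symdiff A B = symdiff B A.
Proof. by apply/setP => v; rewrite !inE addbC. Qed.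

Lemma symdiffA (I : finType) (A B D : {set I}) :
  symdiff A (symdiff B D) = symdiff (symdiff A B) D.
Proof. by apply/setP => v; rewrite !inE addbA. Qed.

Lemma symdiffK (I : finType) (A B : {set I}) : symdiff A (symdiff A B) = B.
Proof. by apply/setP => v; rewrite !inE addKb. Qed.

Lemma symdiffxx (I : finType) (A : {set I}) : symdiff A A = set0.
Proof. by apply/setP => v; rewrite !inE addbb. Qed.

Lemma symdiff0 (I : finType) (A : {set I}) : symdiff set0 A = A.
Proof. by apply/setP => v; rewrite !inE. Qed.

Lemma symdiff_eq0 (I : finType) (A B : {set I}) :
  (symdiff A B == set0) = (A == B).
Proof.
apply/eqP/eqP => [AB0|->]; last exact: symdiffxx.
by rewrite -[B](symdiffK A) AB0 symdiffC symdiff0.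
Qed.

Lemma card_symdiff_le (I : finType) (A B : {set I}) :
  (#|symdiff A B| <= #|A| + #|B|)%N.
Proof.
apply: leq_trans (leq_card_setU A B); apply/subset_leq_card/subsetP => v.
by rewrite !inE; case: (v \in A); case: (v \in B).
Qed.

(** Walsh character of A; [true] stands for the sign -1. *)
Definition chi A x : R := \prod_(v in A) (-1) ^+ x v.

Lemma chi0 x : chi set0 x = 1.
Proof. by rewrite /chi big_set0. Qed.

Lemma chi1 v x : chi [set v] x = (-1) ^+ x v.
Proof. by rewrite /chi big_set1. Qed.

Lemma chiM A B x : chi A x * chi B x = chi (symdiff A B) x.
Proof.
rewrite /chi !(big_mkcond (fun v => v \in _)) -big_split /=.
apply: eq_bigr => v _; rewrite inE.
by case: (v \in A); case: (v \in B); rewrite ?mulr1 ?mul1r // -expr2 sqrr_sign.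
Qed.

Lemma chi_sqr A x : chi A x ^+ 2 = 1.
Proof. by rewrite expr2 chiM symdiffxx chi0. Qed.

Definition avg (f : {ffun V -> bool} -> R) : R :=
  (\sum_x f x) / (2 ^ #|V|)%:R.

Lemma eq_avg f g : f =1 g -> avg f = avg g.
Proof. by move=> fg; congr (_ / _); apply: eq_bigr. Qed.

Lemma avg_lin a f g : avg (fun x => a * f x + g x) = a * avg f + avg g.
Proof. by rewrite /avg big_split -mulr_sumr mulrDl mulrA. Qed.

Lemma avgZ a f : avg (fun x => a * f x) = a * avg f.
Proof. by rewrite /avg -mulr_sumr mulrA. Qed.

Lemma avg_sum (I : finType) (P : pred I) (F : I -> {ffun V -> bool} -> R) :
  avg (fun x => \sum_(i | P i) F i x) = \sum_(i | P i) avg (F i).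
Proof. by rewrite /avg exchange_big mulr_suml. Qed.

Lemma avg_chi A : avg (chi A) = (A == set0)%:R.
Proof.
have sumE : \sum_x chi A x = \prod_(v : V) \sum_(b : bool)
    (if v \in A then (-1) ^+ b else 1).
  by rewrite bigA_distr_bigA /=; apply: eq_bigr => x _; rewrite /chi big_mkcond.
rewrite /avg sumE; have [->|/set0Pn[v vA]] := eqVneq A set0.
  rewrite (eq_bigr (fun=> 2)); last by move=> v _; rewrite big_bool inE.
  by rewrite prodr_const natrX divff // expf_neq0 // pnatr_eq0.
rewrite (bigD1 v) //= big_bool vA /= expr1 expr0 addNr !mul0r.
by [].
Qed.

Lemma avg1 : avg (fun=> 1) = 1.
Proof. by rewrite (eq_avg (g := chi set0)) ?avg_chi ?eqxx // => x; rewrite chi0. Qed.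

(** Degree is the existence of an expansion over small characters: closure under sums and products
    then never calls for uniqueness of coefficients. *)
Definition lowdeg (d : nat) (f : {ffun V -> bool} -> R) : Prop :=
  exists c : {set V} -> R, f =1 (fun x => \sum_(A : {set V} | (#|A| <= d)%N) c A * chi A x).

Lemma eq_lowdeg d f g : f =1 g -> lowdeg d f -> lowdeg d g.
Proof. by move=> fg [c fE]; exists c => x; rewrite -fg. Qed.

Lemma lowdeg_chi d A : (#|A| <= d)%N -> lowdeg d (chi A).
Proof.
move=> Ad; exists (fun B => (B == A)%:R) => x.
rewrite (bigD1 A) //= eqxx mul1r big1 ?addr0 // => B /andP[_ /negPf->].
by rewrite mul0r.
Qed.

Lemma lowdeg_lin d a f g :
  lowdeg d f -> lowdeg d g -> lowdeg d (fun x => a * f x + g x).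
Proof.
move=> [c fE] [c' gE]; exists (fun A => a * c A + c' A) => x.
rewrite fE gE mulr_sumr -big_split /=; apply: eq_bigr => A _.
by rewrite mulrDl mulrA.
Qed.

Lemma lowdeg0 d : lowdeg d (fun=> 0).
Proof. by exists (fun=> 0) => x; rewrite big1 // => A; rewrite mul0r. Qed.

Lemma lowdegD d f g : lowdeg d f -> lowdeg d g -> lowdeg d (fun x => f x + g x).
Proof.
by move=> lf lg; apply: eq_lowdeg (lowdeg_lin 1 lf lg) => x; rewrite mul1r.
Qed.

Lemma lowdegZ d a f : lowdeg d f -> lowdeg d (fun x => a * f x).
Proof.
by move=> lf; apply: eq_lowdeg (lowdeg_lin a lf (lowdeg0 d)) => x; rewrite addr0.
Qed.

Lemma lowdeg_cst d a : lowdeg d (fun=> a).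
Proof.
have l0 : lowdeg d (chi set0) by apply: lowdeg_chi; rewrite cards0.
by apply: eq_lowdeg (lowdegZ a l0) => x; rewrite chi0 mulr1.
Qed.

Lemma lowdeg_sum d (I : Type) (s : seq I) (P : pred I) (F : I -> {ffun V -> bool} -> R) :
  (forall i, P i -> lowdeg d (F i)) -> lowdeg d (fun x => \sum_(i <- s | P i) F i x).
Proof.
move=> lF; elim: s => [|i s IHs].
  by apply: eq_lowdeg (lowdeg0 d) => x; rewrite big_nil.
case Pi: (P i).
  by apply: eq_lowdeg (lowdegD (lF i Pi) IHs) => x; rewrite big_cons Pi.
by apply: eq_lowdeg IHs => x; rewrite big_cons Pi.
Qed.

Lemma lowdegM a b f g : lowdeg a f -> lowdeg b g -> lowdeg (a + b) (fun x => f x * g x).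
Proof.
move=> [c fE] [c' gE].
apply: (@eq_lowdeg _ (fun x => \sum_(A : {set V} | (#|A| <= a)%N)
   \sum_(B : {set V} | (#|B| <= b)%N) c A * c' B * chi (symdiff A B) x)).
  move=> x; rewrite fE gE mulr_suml; apply: eq_bigr => A _.
  by rewrite mulr_sumr; apply: eq_bigr => B _; rewrite -chiM mulrACA.
apply: lowdeg_sum => A lA; apply: lowdeg_sum => B lB; apply/lowdegZ/lowdeg_chi.
exact: leq_trans (card_symdiff_le A B) (leq_add lA lB).
Qed.

Lemma lowdeg_leq a b f : (a <= b)%N -> lowdeg a f -> lowdeg b f.
Proof.
move=> ab [c fE]; apply: eq_lowdeg (fun x => esym (fE x)) _.
by apply: lowdeg_sum => A lA; apply/lowdegZ/lowdeg_chi/(leq_trans lA).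
Qed.

Lemma lowdegX a f k : lowdeg a f -> lowdeg (a * k) (fun x => f x ^+ k).
Proof.
move=> lf; elim: k => [|k IHk]; first exact: lowdeg_cst.
by rewrite mulnS; apply: eq_lowdeg (lowdegM lf IHk) => x; rewrite exprS.
Qed.

Lemma lowdeg_prod (I : Type) (s : seq I) (D : I -> nat) (F : I -> {ffun V -> bool} -> R) :
  (forall i, lowdeg (D i) (F i)) ->
  lowdeg (\sum_(i <- s) D i) (fun x => \prod_(i <- s) F i x).
Proof.
move=> lF; elim: s => [|i s IHs].
  by apply: eq_lowdeg (lowdeg_cst _ 1) => x; rewrite big_nil.
by rewrite big_cons; apply: eq_lowdeg (lowdegM (lF i) IHs) => x; rewrite big_cons.
Qed.

End Cube.

(** * The pseudo-expectation of an expanding XOR system *)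

Section XorExpectation.
Variables (R : realFieldType) (V J : finType).
Variables (C : J -> {set V}) (b : J -> R) (d : nat).
Hypothesis b_sqr : forall j, b j ^+ 2 = 1.

(** The iterated symmetric difference of the scopes, that is, the support of the product of the
    clauses in T. *)
Definition span (T : {set J}) : {set V} :=
  [set v | odd #|[set j in T | v \in C j]|].

Hypothesis expansion : forall T : {set J},
  (0 < #|T| <= 3 * d)%N -> (#|T| <= #|span T|)%N.

Definition clause j x : R := b j * chi R (C j) x.
Definition clauses (T : {set J}) x : R := \prod_(j in T) clause j x.

Lemma prod_chi (T : {set J}) x : \prod_(j in T) chi R (C j) x = chi R (span T) x.
Proof.
rewrite /chi; under eq_bigr => j _ do rewrite (big_mkcond (fun v => v \in _)).
rewrite exchange_big [RHS]big_mkcond /=; apply: eq_bigr => v _.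
rewrite -big_mkcondr /= (eq_bigl (fun j => j \in [set j in T | v \in C j])).
  rewrite prodr_const inE; case: (x v); last by rewrite expr1n; case: ifP.
  by rewrite expr1 -signr_odd; case: odd.
by move=> j; rewrite inE.
Qed.

Lemma clausesE (T : {set J}) x : clauses T x = (\prod_(j in T) b j) * chi R (span T) x.
Proof. by rewrite /clauses big_split prod_chi. Qed.

Lemma clause_sqr j x : clause j x ^+ 2 = 1.
Proof. by rewrite exprMn b_sqr chi_sqr mulr1. Qed.

Lemma clausesM S T x : clauses S x * clauses T x = clauses (symdiff S T) x.
Proof.
rewrite /clauses !(big_mkcond (fun j => j \in _)) -big_split /=.
apply: eq_bigr => j _; rewrite inE.
by case: (j \in S); case: (j \in T); rewrite ?mulr1 ?mul1r // -expr2 clause_sqr.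
Qed.

Lemma clauses_sqr T x : clauses T x ^+ 2 = 1.
Proof. by rewrite expr2 clausesM symdiffxx /clauses big_set0. Qed.

Lemma clauses_coef_sqr (T : {set J}) : (\prod_(j in T) b j) ^+ 2 = 1.
Proof. by rewrite -prodrXl big1. Qed.

(* The average against the low-degree part of prod_j (1 + z_j), where z_j is the
   j-th clause: up to normalisation, the density of the uniform law on satisfying
   assignments. *)
Definition xorE (f : {ffun V -> bool} -> R) : R :=
  \sum_(T : {set J} | (#|T| <= 2 * d)%N) avg (fun x => f x * clauses T x).

Lemma eq_xorE f g : f =1 g -> xorE f = xorE g.
Proof. by move=> fg; apply: eq_bigr => T _; apply: eq_avg => x; rewrite fg. Qed.

Lemma xorE_lin a f g : xorE (fun x => a * f x + g x) = a * xorE f + xorE g.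
Proof.
rewrite /xorE mulr_sumr -big_split; apply: eq_bigr => T _ /=.
by rewrite -avg_lin; apply: eq_avg => x; rewrite mulrDl mulrA.
Qed.

Lemma xorE0 : xorE (fun=> 0) = 0.
Proof.
rewrite /xorE big1 // => T _; rewrite /avg big1 ?mul0r // => x _.
by rewrite mul0r.
Qed.

Lemma xorED f g : xorE (fun x => f x + g x) = xorE f + xorE g.
Proof.
by rewrite -[xorE f]mul1r -xorE_lin; apply: eq_xorE => x; rewrite mul1r.
Qed.

Lemma xorEZ a f : xorE (fun x => a * f x) = a * xorE f.
Proof.
by rewrite -[RHS]addr0 -xorE0 -xorE_lin; apply: eq_xorE => x; rewrite addr0.
Qed.

Lemma xorE_sum (I : Type) (s : seq I) (P : pred I) (F : I -> {ffun V -> bool} -> R) :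
  xorE (fun x => \sum_(i <- s | P i) F i x) = \sum_(i <- s | P i) xorE (F i).
Proof.
elim: s => [|i s IHs].
  by rewrite big_nil -[RHS]xorE0; apply: eq_xorE => x; rewrite big_nil.
rewrite big_cons; case Pi: (P i).
  by rewrite -IHs -xorED; apply: eq_xorE => x; rewrite big_cons Pi.
by rewrite -IHs; apply: eq_xorE => x; rewrite big_cons Pi.
Qed.

(* A low-degree function only sees the sets T with |T| <= |span T| <= d, so any
   cut-off between d and 3 d gives the same functional. *)
Lemma avg_clauses_eq0 f (T : {set J}) : lowdeg d f -> (d < #|T| <= 3 * d)%N ->
  avg (fun x => f x * clauses T x) = 0.
Proof.
move=> [c fE] /andP[dT T3d].
rewrite (eq_avg (g := fun x => \sum_(A : {set V} | (#|A| <= d)%N)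
   (c A * \prod_(j in T) b j) * chi R (symdiff A (span T)) x)).
  rewrite avg_sum big1 // => A Ad; rewrite avgZ avg_chi symdiff_eq0.
  have [AT|_] := eqVneq A; last by rewrite mulr0.
  have : (#|T| <= #|span T|)%N by apply: expansion; rewrite T3d (leq_trans _ dT).
  by rewrite -AT leqNgt (leq_ltn_trans Ad dT).
move=> x; rewrite fE mulr_suml; apply: eq_bigr => A _.
by rewrite clausesE -chiM mulrACA.
Qed.

Lemma xorE_family f (P : pred {set J}) : lowdeg d f ->
  (forall T : {set J}, (#|T| <= d)%N -> P T) -> (forall T, P T -> (#|T| <= 3 * d)%N) ->
  \sum_(T | P T) avg (fun x => f x * clauses T x) = xorE f.
Proof.
move=> lf dP Pd.
have small (Q : pred {set J}) : (forall T : {set J}, (#|T| <= d)%N -> Q T) ->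
    (forall T, Q T -> (#|T| <= 3 * d)%N) ->
    \sum_(T | Q T) avg (fun x => f x * clauses T x) =
    \sum_(T : {set J} | (#|T| <= d)%N) avg (fun x => f x * clauses T x).
  move=> dQ Qd; rewrite (bigID (fun T : {set J} => (#|T| <= d)%N)) /= addrC big1.
    by rewrite add0r; apply: eq_bigl => T; case Td: (_ <= _)%N; rewrite ?andbT ?andbF ?dQ.
  by move=> T /andP[QT]; rewrite -ltnNge => dT; rewrite avg_clauses_eq0 // dT Qd.
rewrite small // /xorE small // => T; lia.
Qed.

(** Multiplying by [clauses S] translates the index T by S. The translated family contains every T
    of size at most d and none of size above 3 * d, so it computes the same functional; this
    dictates the cut-off 2 * d in [xorE]. *)
Lemma xorE_clauses f (S : {set J}) : lowdeg d f -> (#|S| <= d)%N ->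
  xorE (fun x => clauses S x * f x) = xorE f.
Proof.
move=> lf Sd.
rewrite /xorE; under eq_bigr => T _ do under eq_avg => x do
  rewrite mulrAC clausesM mulrC.
rewrite (reindex (symdiff S)) /=; last first.
  by exists (symdiff S) => T _; rewrite symdiffK.
under eq_bigr => T _ do rewrite symdiffK.
apply: xorE_family => // T Td.
  by apply: leq_trans (card_symdiff_le _ _) _; lia.
by rewrite -[T](symdiffK S); apply: leq_trans (card_symdiff_le _ _) _; lia.
Qed.

Lemma xorE1 : xorE (fun=> 1) = 1.
Proof.
rewrite /xorE (bigD1 set0) ?cards0 //= big1 ?addr0.
  rewrite -[RHS](avg1 R V); apply: eq_avg => x.
  by rewrite /clauses big_set0 mulr1.
move=> T /andP[Td Tn0].
have T_gt0 : (0 < #|T|)%N by rewrite card_gt0.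
rewrite (eq_avg (g := fun x => (\prod_(j in T) b j) * chi R (span T) x)).
  rewrite avgZ avg_chi -cards_eq0.
  have : (#|T| <= #|span T|)%N by apply: expansion; lia.
  by case: (#|span T|) => [|k]; rewrite ?mulr0 //; lia.
by move=> x; rewrite mul1r clausesE.
Qed.

Let e (A : {set V}) : R := xorE (chi R A).

(** A nonzero pseudo-expectation means that A is the span of a small T: the constraints of T
    multiply to a derivation of the value of [chi R A]. *)
Lemma xorE_chi_neq0 (A : {set V}) : (#|A| <= d)%N -> e A != 0 ->
  exists2 T : {set J}, (#|T| <= d)%N & chi R A =1 (fun x => e A * clauses T x).
Proof.
move=> Ad eA; have lA := lowdeg_chi R Ad.
have [T /andP[Td /eqP AT]] : exists T : {set J}, (#|T| <= d)%N && (span T == A).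
  apply/existsP; apply: contraNT eA; rewrite negb_exists => /forallP noT.
  (* Cutting off at d rather than 2 * d makes the T found here small enough for [xorE_clauses]. *)
  apply/eqP; rewrite /e -(xorE_family (P := fun T : {set J} => #|T| <= d)%N) //; last first.
    by move=> T; lia.
  rewrite big1 // => T Td; have := noT T; rewrite Td /= => ATF.
  rewrite (eq_avg (g := fun x => (\prod_(j in T) b j) * chi R (symdiff A (span T)) x)).
    by rewrite avgZ avg_chi symdiff_eq0 eq_sym (negPf ATF) mulr0.
  by move=> x; rewrite clausesE mulrCA chiM.
exists T => //.
have chiE : chi R A =1 (fun x => (\prod_(j in T) b j) * clauses T x).
  by move=> x; rewrite clausesE mulrA -expr2 clauses_coef_sqr mul1r AT.
suff -> : e A = \prod_(j in T) b j by [].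
rewrite /e (eq_xorE chiE) xorEZ.
have := xorE_clauses (lowdeg_cst V d 1) Td.
under eq_xorE => x do rewrite mulr1.
by move=> ->; rewrite xorE1 mulr1.
Qed.

Lemma xorE_chi_sqr (A : {set V}) : (#|A| <= d)%N -> e A != 0 -> e A ^+ 2 = 1.
Proof.
move=> Ad eA; have [T _ /(_ [ffun=> false])] := xorE_chi_neq0 Ad eA.
move/(congr1 (fun r => r ^+ 2)).
by rewrite exprMn chi_sqr clauses_sqr mulr1.
Qed.

(** The factor [e A ^+ 2] is the indicator of [e A != 0], which makes multiplicativity hold without
    a case distinction. *)
Lemma xorE_chiM (A B : {set V}) : (#|A| <= d)%N -> (#|B| <= d)%N ->
  e A * e B = e A ^+ 2 * e (symdiff A B).
Proof.
move=> Ad Bd; have [->|eA] := eqVneq (e A) 0; first by rewrite expr0n /= !mul0r.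
have [T Td chiE] := xorE_chi_neq0 Ad eA.
have eAB : e (symdiff A B) = e A * e B.
  rewrite -[e B](xorE_clauses (lowdeg_chi R Bd) Td) -xorEZ.
  by apply: eq_xorE => x; rewrite -chiM chiE mulrA.
by rewrite eAB mulrA -exprSr exprS xorE_chi_sqr // mulr1.
Qed.

(* e defines an equivalence relation A ~ B iff e (A + B) != 0 on low-degree sets,
   and e (A + A') = \sum_B e (A + B) e (A' + B) / (size of the class of B) is a
   Gram matrix. *)
Lemma xorE_sqr_ge0 k f : (2 * k <= d)%N -> lowdeg k f -> 0 <= xorE (fun x => f x ^+ 2).
Proof.
move=> kd [c fE].
pose low (A : {set V}) := (#|A| <= k)%N.
have lowD A B : low A -> low B -> (#|symdiff A B| <= d)%N.
  by rewrite /low => Ak Bk; apply: leq_trans (card_symdiff_le A B) _; lia.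
(* The squares are 0 or 1, so this counts the class of B. *)
pose class_size (B : {set V}) : R := \sum_(A | low A) e (symdiff A B) ^+ 2.
have mul3 A B A' : low A -> low B -> low A' ->
    e (symdiff A B) * e (symdiff B A') = e (symdiff A B) ^+ 2 * e (symdiff A A').
  move=> lA lB lA'; rewrite xorE_chiM ?lowD //.
  by rewrite -symdiffA symdiffK.
have size_gt0 B : low B -> 0 < class_size B.
  move=> lB; rewrite /class_size (bigD1 B) //= symdiffxx.
  have -> : e set0 = 1.
    by rewrite -xorE1; apply: eq_xorE => x; rewrite chi0.
  by rewrite expr1n ltr_pwDl // sumr_ge0 // => A _; rewrite sqr_ge0.
have size_eq A B : low A -> low B -> e (symdiff A B) != 0 ->
    class_size B = class_size A.
  move=> lA lB eAB; apply: eq_bigr => A' lA'.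
  have := congr1 (fun r => r ^+ 2) (mul3 A B A' lA lB lA').
  rewrite !exprMn (xorE_chi_sqr (lowD _ _ lA lB) eAB) !mul1r.
  by rewrite (symdiffC A' B) (symdiffC A' A).
have eE A A' : low A -> low A' ->
    e (symdiff A A') = \sum_(B | low B) e (symdiff A B) * e (symdiff A' B) / class_size B.
  move=> lA lA'; rewrite (eq_bigr (fun B =>
    e (symdiff A A') / class_size A * e (symdiff B A) ^+ 2)); last first.
    move=> B lB; rewrite (symdiffC A' B) mul3 // (symdiffC B A).
    have [->|eAB] := eqVneq (e (symdiff A B)) 0; first by rewrite expr0n /= !(mul0r, mulr0).
    by rewrite (size_eq A B) // -mulrA mulrC.
  by rewrite -mulr_sumr -mulrA mulVf ?mulr1 // gt_eqF // size_gt0.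
suff -> : xorE (fun x => f x ^+ 2) = \sum_(B | low B)
    (\sum_(A | low A) c A * e (symdiff A B)) ^+ 2 / class_size B.
  apply: sumr_ge0 => B lB; apply: divr_ge0; first exact: sqr_ge0.
  exact/ltW/size_gt0.
transitivity (\sum_(A | low A) \sum_(A' | low A') c A * c A' * e (symdiff A A')).
  rewrite (eq_xorE (g := fun x => \sum_(A | low A) \sum_(A' | low A')
     c A * c A' * chi R (symdiff A A') x)).
    rewrite xorE_sum; apply: eq_bigr => A _; rewrite xorE_sum.
    by apply: eq_bigr => A' _; rewrite xorEZ.
  move=> x; rewrite fE expr2 mulr_suml; apply: eq_bigr => A _.
  by rewrite mulr_sumr; apply: eq_bigr => A' _; rewrite -chiM mulrACA.
under eq_bigr => A lA do under eq_bigr => A' lA' do rewrite eE // mulr_sumr.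
under eq_bigr => A lA do rewrite exchange_big /=.
rewrite exchange_big /=; apply: eq_bigr => B lB.
rewrite expr2 mulr_suml mulr_suml; apply: eq_bigr => A _.
rewrite mulr_sumr mulr_suml; apply: eq_bigr => A' _.
by rewrite mulrA mulrACA.
Qed.

End XorExpectation.

(** * Discrepancy of random constraints *)

Section Chernoff.
Variables (R : realType).

(** Obtained from exp y <= 1 / (1 - y), itself the tangent bound at -y. *)
Lemma expR_le_quadratic (y : R) : y <= 1 / 2 -> expR y <= 1 + y + 2 * y ^+ 2.
Proof.
move=> y_le; have y1 : 0 < 1 - y by lra.
have := expR_ge1Dx (- y); rewrite expRN => ey.
have ey0 := expR_gt0 y.
have : expR y <= (1 - y)^-1.
  by rewrite -[expR y]invrK lef_pV2 // posrE ?invr_gt0.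
move/le_trans; apply; rewrite -[_^-1]mul1r ler_pdivrMr //.
have y2 : 0 <= y ^+ 2 := sqr_ge0 y.
have -> : (1 + y + 2 * y ^+ 2) * (1 - y) = 1 + y ^+ 2 * (1 - 2 * y) by ring.
by rewrite lerDl mulr_ge0 //; lra.
Qed.

Variables (T : finType) (W : T -> R) (M : nat).
Hypothesis W_le1 : forall t, `|W t| <= 1.
Hypothesis T_gt0 : (0 < #|T|)%N.
Let m : R := (\sum_t W t) / #|T|%:R.

Let T_neq0 : #|T|%:R != 0 :> R.
Proof. by rewrite pnatr_eq0 -lt0n. Qed.

Let sumW : \sum_t W t = #|T|%:R * m.
Proof. by rewrite mulrC divfK. Qed.

Let m_le1 : `|m| <= 1.
Proof.
rewrite normrM normfV normr_nat ler_pdivrMr ?ltr0n // mul1r.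
apply: (le_trans (ler_norm_sum _ _ _)).
by apply: le_trans (ler_sum _ (fun t _ => W_le1 t)) _; rewrite sumr_const.
Qed.

(** Since |W t - m| <= 2, the bound a <= 1/4 keeps the exponent within 1/2; the linear terms cancel
    on average and the variance is at most 1. *)
Lemma exp_moment (a : R) : 0 <= a <= 1 / 4 ->
  \sum_t expR (a * (W t - m)) <= #|T|%:R * expR (2 * a ^+ 2).
Proof.
move=> a_bnd.
apply: (@le_trans _ _ (\sum_t (1 + a * (W t - m) + 2 * (a * (W t - m)) ^+ 2))).
  apply: ler_sum => t _; apply: expR_le_quadratic.
  have := W_le1 t; have := m_le1; rewrite !ler_norml => ? ?; nra.
rewrite (eq_bigr (fun t => (1 - a * m + 2 * a ^+ 2 * m ^+ 2) +
   ((a - 4 * a ^+ 2 * m) * W t + 2 * a ^+ 2 * W t ^+ 2))); last by move=> t _; ring.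
rewrite big_split /= sumr_const -[_ *+ #|_|]mulr_natl big_split /= -!mulr_sumr sumW.
have W2 : \sum_t W t ^+ 2 <= #|T|%:R.
  rewrite -[X in _ <= X](_ : \sum_(t : T) 1 = _); last by rewrite sumr_const.
  by apply: ler_sum => t _; rewrite -[_ ^+ 2]real_normK ?num_real // expr_le1.
apply: (@le_trans _ _ (#|T|%:R * (1 + 2 * a ^+ 2))); last first.
  by rewrite ler_pM2l ?ltr0n // expR_ge1Dx.
have a2 := sqr_ge0 a; have am2 := sqr_ge0 (a * m).
have T0 : 0 <= #|T|%:R :> R by [].
move: (#|T|%:R) W2 T0 => c W2 T0.
have : 2 * a ^+ 2 * \sum_t W t ^+ 2 <= 2 * a ^+ 2 * c by apply: ler_wpM2l => //; lra.
have : 0 <= c * (a * m) ^+ 2 by apply: mulr_ge0.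
move=> h1 h2.
have -> : c * (1 + 2 * a ^+ 2) = c + 2 * a ^+ 2 * c by ring.
have -> : c * (1 - a * m + 2 * a ^+ 2 * m ^+ 2) + ((a - 4 * a ^+ 2 * m) * (c * m) +
   2 * a ^+ 2 * \sum_t W t ^+ 2) = c - 2 * (c * (a * m) ^+ 2) + 2 * a ^+ 2 * \sum_t W t ^+ 2 by ring.
by lra.
Qed.

Lemma chernoff (delta : R) : 0 <= delta <= 1 ->
  #|[set f : {ffun 'I_M -> T} | delta * M%:R < \sum_j (W (f j) - m)]|%:R
    <= #|{ffun 'I_M -> T}|%:R * expR (- (delta ^+ 2 * M%:R / 8)).
Proof.
(* This a minimises 2 a^2 - a delta, with minimum - delta^2 / 8. *)
move=> d_bnd; pose a := delta / 4.
have a_bnd : 0 <= a <= 1 / 4 by rewrite /a; lra.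
set bad := [set f | _].
have sumE : \sum_(f : {ffun 'I_M -> T}) expR (a * \sum_j (W (f j) - m))
    = (\sum_t expR (a * (W t - m))) ^+ M.
  rewrite -[in RHS](card_ord M) -prodr_const bigA_distr_bigA /=.
  by apply: eq_bigr => f _; rewrite mulr_sumr expR_sum.
have moment : \sum_(f : {ffun 'I_M -> T}) expR (a * \sum_j (W (f j) - m))
    <= #|{ffun 'I_M -> T}|%:R * expR (2 * a ^+ 2 * M%:R).
  rewrite sumE card_ffun card_ord natrX expRM_natr -exprMn.
  apply: lerXn2r; rewrite ?exp_moment // nnegrE ?mulr_ge0 ?expR_ge0 //.
  by apply: sumr_ge0 => t _; exact: expR_ge0.
have badE : #|bad|%:R * expR (a * (delta * M%:R)) <=
    \sum_(f : {ffun 'I_M -> T}) expR (a * \sum_j (W (f j) - m)).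
  rewrite mulr_natl -sumr_const [X in _ <= X](bigID (mem bad)) /=.
  apply: (@le_trans _ _ (\sum_(f in bad) expR (a * \sum_j (W (f j) - m)))).
    apply: ler_sum => f; rewrite inE => f_bad; rewrite ler_expR.
    by apply: ler_wpM2l; [case/andP: a_bnd | exact: ltW].
  by rewrite lerDl sumr_ge0 // => f _; exact: expR_ge0.
have := le_trans badE moment; rewrite -ler_pdivlMr ?expR_gt0 // => /le_trans; apply.
rewrite -expRN -[leLHS]mulrA -expRD le_eqVlt; apply/orP; left; apply/eqP.
by congr (_ * expR _); rewrite /a; field.
Qed.

End Chernoff.

Lemma leq_card_bigcup (I T : finType) (P : pred I) (F : I -> {set T}) :
  (#|\bigcup_(i | P i) F i| <= \sum_(i | P i) #|F i|)%N.
Proof.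
elim/big_rec2: _ => [|i n A _ An]; first by rewrite cards0.
exact: leq_trans (leq_card_setU _ _) (leq_add _ An).
Qed.

Section Discrepancy.
Variables (R : realType) (I L : finType) (M : nat).
Hypothesis L_gt0 : (0 < #|L|)%N.
Implicit Types (y : I -> L -> R) (f : {ffun 'I_M -> {ffun I -> L}}).

Definition mean (g : L -> R) : R := (\sum_l g l) / #|L|%:R.

(** One-sided: the lower bound is recovered by negating one of the functions y i. *)
Definition discrepancy f y : R :=
  \sum_j \prod_i y i (f j i) - M%:R * \prod_i mean (y i).

Lemma mean_prod y :
  (\sum_(q : {ffun I -> L}) \prod_i y i (q i)) / #|{ffun I -> L}|%:R
  = \prod_i mean (y i).
Proof.
rewrite prodf_div bigA_distr_bigA /= card_ffun natrX prodr_const.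
by rewrite -[#|I|]/(#|xpredT|).
Qed.

Definition signs (x : {ffun I * L -> bool}) : I -> L -> R :=
  fun i l => (-1) ^+ x (i, l).

(** Reduces the continuum of functions y to finitely many sign vectors, over which a union bound is
    possible. *)
Lemma discrepancy_signs (delta : R) f :
  (forall x, discrepancy f (signs x) <= delta) ->
  forall y, (forall i l, `|y i l| <= 1) -> discrepancy f y <= delta.
Proof.
move=> signs_le y y_le1.
pose rounded (A : {set I}) y := forall i l, i \in A -> `|y i l| = 1.
(* [discrepancy] is linear in each [y k], so [y k] can be replaced by a sign vector. *)
have round k A y0 : (forall i l, `|y0 i l| <= 1) -> rounded A y0 ->
    exists y1, [/\ forall i l, `|y1 i l| <= 1, rounded (k |: A) y1 &
      discrepancy f y0 <= discrepancy f y1].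
  move=> y0_le1 y0A.
  pose g l := \sum_(j | f j k == l) \prod_(i | i != k) y0 i (f j i) -
    M%:R * (\prod_(i | i != k) mean (y0 i)) / #|L|%:R.
  have discE y1 : (forall i, i != k -> y1 i = y0 i) ->
      discrepancy f y1 = \sum_l y1 k l * g l.
    move=> y10; rewrite /discrepancy.
    under [RHS]eq_bigr => l _ do rewrite mulrBr.
    rewrite sumrB; congr (_ - _).
      under [RHS]eq_bigr => l _ do rewrite mulr_sumr.
      rewrite (exchange_big_dep xpredT) //=; apply: eq_bigr => j _.
      rewrite (big_pred1 (f j k)) => [|l]; last by rewrite eq_sym.
      rewrite (bigD1 k) //=.
      by congr (_ * _); apply: eq_bigr => i ik; rewrite y10.
    rewrite (bigD1 k) //= {1}/mean -mulr_suml.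
    under [in LHS]eq_bigr => i ik do rewrite y10 //.
    by field; rewrite pnatr_eq0 -lt0n.
  pose y1 i l := if i == k then (if 0 <= g l then 1 else -1) else y0 i l.
  have y1k i l : i == k -> `|y1 i l| = 1.
    by rewrite /y1 => ->; case: ifP => _; rewrite ?normrN normr1.
  exists y1; split.
  - move=> i l; have [ik|/negPf ik] := boolP (i == k); first by rewrite y1k.
    by rewrite /y1 ik.
  - move=> i l; rewrite !inE; have [ik _|/negPf ik iA] := boolP (i == k).
      by rewrite y1k.
    by rewrite /y1 ik y0A.
  rewrite !discE // ; last first.
    by move=> i /negPf ik; rewrite /y1 ik.
  apply: ler_sum => l _; rewrite /y1 eqxx; have := y0_le1 k l; rewrite ler_norml.
  by case: ifP => [|/negbT]; rewrite -?ltNge => ? ?; nra.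
have [y1 [_ y1T y1_le]] : exists y1, [/\ forall i l, `|y1 i l| <= 1,
    rounded setT y1 & discrepancy f y <= discrepancy f y1].
  have -> : [set: I] = [set i in enum I] by apply/setP => i; rewrite !inE mem_enum.
  elim: (enum I) => [|k s [y1 [y1_le1 y1s y1_le]]].
    by exists y; split => // i l; rewrite inE.
  have [y2 [y2_le1 y2s y2_le]] := round k _ y1 y1_le1 y1s.
  exists y2; split => //; last exact: le_trans y2_le.
  by move=> i l; rewrite inE in_cons => iks; apply: y2s; rewrite !inE.
apply: (le_trans y1_le).
pose x := [ffun p : I * L => y1 p.1 p.2 < 0].
have y1E i l : y1 i l = signs x i l.
  have := y1T i l (in_setT i); rewrite /signs ffunE /=.
  by case: ltP => y10; [rewrite ltr0_norm | rewrite ger0_norm] => //= y11; lra.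
rewrite (_ : discrepancy f y1 = discrepancy f (signs x)) //.
congr (_ - _ * _); first by apply: eq_bigr => j _; apply: eq_bigr.
by apply: eq_bigr => i _; congr (_ / _); apply: eq_bigr.
Qed.

(** Union bound over sign vectors; the independent draws fed to [chernoff] are whole constraints. *)
Lemma discrepancy_prob (delta : R) : 0 <= delta <= 1 ->
  #|[set f | [exists x, delta * M%:R < discrepancy f (signs x)]]|%:R
  <= #|{ffun 'I_M -> {ffun I -> L}}|%:R *
     ((2 ^ (#|I| * #|L|))%:R * expR (- (delta ^+ 2 * M%:R / 8))) :> R.
Proof.
move=> delta_bnd.
pose bad x := [set f | delta * M%:R < discrepancy f (signs x)].
apply: (@le_trans _ _ (\sum_(x : {ffun I * L -> bool}) #|bad x|%:R)).
  rewrite -natr_sum ler_nat.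
  apply: leq_trans (leq_card_bigcup _ bad); apply/subset_leq_card/subsetP => f.
  rewrite inE => /existsP[x fx]; apply/bigcupP; exists x => //.
  by rewrite inE.
apply: (@le_trans _ _ (\sum_(x : {ffun I * L -> bool})
  #|{ffun 'I_M -> {ffun I -> L}}|%:R * expR (- (delta ^+ 2 * M%:R / 8)))).
  apply: ler_sum => x _.
  have W_le1 (q : {ffun I -> L}) : `|\prod_i signs x i (q i)| <= 1.
    rewrite normr_prod; apply: prodr_ile1 => i _.
    by rewrite normr_ge0 /signs normr_sign lexx.
  have q_gt0 : (0 < #|{ffun I -> L}|)%N by rewrite card_ffun expn_gt0 L_gt0.
  apply: le_trans (chernoff M W_le1 q_gt0 delta_bnd).
  rewrite ler_nat; apply/subset_leq_card/subsetP => f.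
  by rewrite !inE mean_prod sumrB sumr_const card_ord -[(\prod_i mean _) *+ M]mulr_natl.
have -> : (2 ^ (#|I| * #|L|) = #|{ffun I * L -> bool}|)%N.
  by rewrite card_ffun card_prod card_bool.
by rewrite sumr_const -[_ *+ _]mulr_natl mulrCA.
Qed.

End Discrepancy.

(** * Expansion of random constraints *)

Section Expansion.
Local Open Scope nat_scope.
Variables (N M : nat).
Let Lit := (bool * 'I_N)%type.
Implicit Types (f : {ffun 'I_M -> {ffun 'I_4 -> Lit}}) (T : {set 'I_M}).

Definition scope f (j : 'I_M) : {set 'I_4 * 'I_N} := [set (i, (f j i).2) | i : 'I_4].

Lemma in_scope f j v : (v \in scope f j) = ((f j v.1).2 == v.2).
Proof.
apply/imsetP/eqP => [[i _ ->] //|fv].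
by exists v.1 => //; rewrite fv -surjective_pairing.
Qed.

Lemma card_scope f j : #|scope f j| = 4.
Proof. by rewrite card_imset ?card_ord // => i i' []. Qed.

Definition repeats f T : {set 'I_M * 'I_4} :=
  [set p in setX T setT | [exists j in T, (j < p.1) && ((f j p.2).2 == (f p.1 p.2).2)]].

(* A variable occurring in T but not in its span occurs at least twice. *)
Lemma card_repeats f T : #|span (scope f) T| < #|T| -> 3 * #|T| <= 2 * #|repeats f T|.
Proof.
move=> spanT.
pose cov := \bigcup_(j in T) scope f j.
pose occ (v : 'I_4 * 'I_N) := #|[set j in T | v \in scope f j]|.
have sum_occ : \sum_v occ v = 4 * #|T|.
  rewrite mulnC -sum_nat_const -(eq_bigr _ (fun j _ => card_scope f j)).
  under eq_bigr => v _ do rewrite /occ -sum1_card.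
  under [RHS]eq_bigr => j _ do rewrite -sum1_card.
  rewrite (exchange_big_dep (fun j => j \in T)) /=; last by move=> v j _; rewrite inE => /andP[].
  by apply: eq_bigr => j jT; apply: eq_bigl => v; rewrite inE jT.
(* A covered variable occurs at least twice or lies in the span. *)
have cov2 : 2 * #|cov| <= 4 * #|T| + #|span (scope f) T|.
  rewrite -sum_occ -[#|span _ _|]sum1_card [X in _ + X]big_mkcond -big_split /=.
  rewrite mulnC -sum_nat_const big_mkcond; apply: leq_sum => v _.
  rewrite inE -/(occ v); case: ifP => // /bigcupP[j jT vj].
  have : 0 < occ v by rewrite card_gt0; apply/set0Pn; exists j; rewrite inE jT.
  by case: (occ v) => [|[|k]] //=; case: ifP.
have rep_sub : repeats f T \subset setX T setT.
  by apply/subsetP => p; rewrite inE => /andP[].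
(* Occurrences that are not repeats are first occurrences, hence inject into [cov]. As 2 |cov| < 5
   |T|, more than 3/2 |T| of the 4 |T| occurrences are repeats. *)
have firsts : #|setX T setT :\: repeats f T| <= #|cov|.
  rewrite -(card_in_imset (f := fun p => (p.2, (f p.1 p.2).2))).
    apply/subset_leq_card/subsetP => _ /imsetP[[j i] /setDP[/setXP[jT _] _] ->].
    by apply/bigcupP; exists j => //; rewrite in_scope.
  move=> [j i] [j' i'] /setDP[/setXP[/= jT _] jF] /setDP[/setXP[/= j'T _] j'F] [ii'].
  rewrite -ii' => fij; move: jF j'F; rewrite -ii' !inE jT j'T /= => jF j'F.
  congr (_, _); apply: val_inj; case: (ltngtP j j') => // jj'.
    by case/existsP: j'F; exists j; rewrite jT jj' fij eqxx.
  by case/existsP: jF; exists j'; rewrite j'T jj' fij eqxx.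
have card_all : #|setX T [set: 'I_4]| = 4 * #|T| by rewrite cardsX cardsT card_ord mulnC.
move: firsts; rewrite cardsD (setIidPr rep_sub) card_all.
have := subset_leq_card rep_sub; rewrite card_all {card_all sum_occ}.
move: spanT cov2; move: #|span _ _| #|repeats f T| #|cov| #|T| => *; lia.
Qed.

Lemma card_family_prod (aT : finType) (rT : finType) (F : aT -> pred rT) :
  #|(family F : pred {ffun aT -> rT})| = \prod_p #|F p|.
Proof.
by rewrite card_family foldrE big_map big_enum.
Qed.

(* A repeated literal is encoded by its sign and a pointer to an earlier clause
   of T, so that it has only 2 |T| instead of 2 N possible values. *)
Lemma card_repeating T (Q : {set 'I_M * 'I_4}) :
  #|[set f | Q \subset repeats f T]| * (2 * N) ^ #|Q| <=
  #|{ffun 'I_M -> {ffun 'I_4 -> Lit}}| * (2 * #|T|) ^ #|Q|.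
Proof.
(* The default p.1 is never reached at a p in [repeats f T]. *)
pose pointer f (p : 'I_M * 'I_4) := odflt p.1 [pick j in T |
  (j < p.1) && ((f j p.2).2 == (f p.1 p.2).2)].
pose code f : {ffun 'I_M * 'I_4 -> Lit + bool * 'I_M} :=
  [ffun p => if p \in Q then inr ((f p.1 p.2).1, pointer f p) else inl (f p.1 p.2)].
pose F (p : 'I_M * 'I_4) : pred (Lit + bool * 'I_M) := fun w =>
  match w with inl _ => p \notin Q | inr w' => (p \in Q) && (w'.2 \in T) end.
have pointerP f p : p \in repeats f T ->
    [/\ pointer f p \in T, pointer f p < p.1 &
        (f (pointer f p) p.2).2 = (f p.1 p.2).2].
  rewrite inE => /andP[_ /existsP[j jP]]; rewrite /pointer.
  by case: pickP => [j' /and3P[? ? /eqP ?] //|/(_ j)]; rewrite jP.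
have code_inj : {in [set f | Q \subset repeats f T] &, injective code}.
  move=> f g; rewrite !inE => /subsetP fQ /subsetP gQ fg.
  (* Decoding goes by induction on the clause index: a pointer leads to a strictly earlier clause,
     already recovered. *)
  have fgE i : forall k (j : 'I_M), j < k -> f j i = g j i.
    elim=> // k IHk j; rewrite ltnS => jk.
    have := congr1 (fun h : {ffun _} => h (j, i)) fg; rewrite !ffunE.
    case: ifP => [jiQ|_ [->] //] [sE ptE].
    have [_ ltf fE] := pointerP _ _ (fQ _ jiQ).
    have [_ ltg gE] := pointerP _ _ (gQ _ jiQ).
    rewrite [f j i]surjective_pairing [g j i]surjective_pairing sE.
    by rewrite -[(f j i).2]fE -[(g j i).2]gE ptE IHk // (leq_trans ltg).
  by apply/ffunP => j; apply/ffunP => i; apply: (fgE i j.+1).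
have card_code : #|[set f | Q \subset repeats f T]| <= \prod_p #|F p|.
  rewrite -(card_in_imset code_inj) -card_family_prod.
  apply/subset_leq_card/subsetP => _ /imsetP[f + ->]; rewrite inE => /subsetP fQ.
  apply/familyP => p; rewrite ffunE; case: ifP => pQ; rewrite unfold_in /F pQ //=.
  by have [-> _ _] := pointerP _ _ (fQ _ pQ).
have cardF p : #|F p| = if p \in Q then 2 * #|T| else 2 * N.
  case: ifP => pQ.
    rewrite (_ : #|F p| = #|[set inr w | w in setX [set: bool] T] : {set Lit + bool * 'I_M}|).
      by rewrite card_imset ?cardsX ?cardsT ?card_bool // => ? ? [].
    apply: eq_card => -[w|w]; rewrite unfold_in /= pQ /=.
      by apply/esym/negbTE/imsetP => -[].
    apply/idP/imsetP => [wT|[w' + [->]]]; last by rewrite !inE => /andP[].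
    by exists w => //; rewrite !inE.
  rewrite (_ : #|F p| = #|[set inl w | w in [set: Lit]] : {set Lit + bool * 'I_M}|).
    rewrite card_imset ?cardsT ?card_prod ?card_bool ?card_ord // => ? ? [] //.
  apply: eq_card => -[w|w]; rewrite unfold_in /= pQ /=.
    by apply/esym/imsetP; exists w; rewrite ?inE.
  by apply/esym/negbTE/imsetP => -[].
apply: leq_trans (leq_mul card_code (leqnn _)) _.
rewrite (eq_bigr _ (fun p _ => cardF p)) (bigID (mem Q)) /=.
rewrite (eq_bigr (fun=> 2 * #|T|)); last by move=> p pQ; rewrite ifT.
rewrite prod_nat_const (eq_bigr (fun=> 2 * N)); last by move=> p pQ; rewrite ifN.
rewrite prod_nat_const -mulnA -expnD mulnC.
have -> : #|[pred p | p \notin Q]| + #|Q| = M * 4.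
  by rewrite addnC cardC card_prod !card_ord.
by rewrite card_ffun card_ffun card_prod card_bool !card_ord -expnM (mulnC 4).
Qed.

Lemma exists_subset_card (aT : finType) (A : {set aT}) k :
  k <= #|A| -> exists2 B : {set aT}, B \subset A & #|B| = k.
Proof.
move=> kA; exists [set x in take k (enum A)].
  by apply/subsetP => x; rewrite inE => /mem_take; rewrite mem_enum.
rewrite cardsE (card_uniqP _) ?take_uniq ?enum_uniq // size_takel //.
by rewrite -cardE.
Qed.

(** r is 3/2 |T| rounded up, the number of repeats that [card_repeats] forces. One fixes a set Q of
    exactly r repeats, for which there are at most 2^(4 |T|) = 16^|T| choices. *)
Lemma card_nonexpanding T (r : nat) : r = #|T| + uphalf #|T| ->
  #|[set f | #|span (scope f) T| < #|T|]| * N ^ r <=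
  #|{ffun 'I_M -> {ffun 'I_4 -> Lit}}| * 16 ^ #|T| * #|T| ^ r.
Proof.
move=> rE; pose P (Q : {set 'I_M * 'I_4}) := (Q \subset setX T setT) && (#|Q| == r).
have nonexp_sub : [set f | #|span (scope f) T| < #|T|] \subset
    \bigcup_(Q | P Q) [set f | Q \subset repeats f T].
  apply/subsetP => f; rewrite inE => /card_repeats rep3.
  have [|Q Qrep Qr] := @exists_subset_card _ (repeats f T) r.
    by rewrite rE uphalf_half; have := odd_double_half #|T|; lia.
  apply/bigcupP; exists Q; rewrite ?inE // /P Qr eqxx andbT.
  by apply: subset_trans Qrep _; apply/subsetP => p; rewrite inE => /andP[].
have card_P : #|P| <= 16 ^ #|T|.
  apply: (@leq_trans #|powerset (setX T [set: 'I_4])|).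
    by apply/subset_leq_card/subsetP => Q /andP[QT _]; rewrite inE.
  by rewrite card_powerset cardsX cardsT card_ord mulnC expnM.
(* The factor 2 ^ r accounts for the signs of literals in [card_repeating]. *)
rewrite -(leq_pmul2r (expn_gt0 2 r : 0 < 2 ^ r)) -mulnA -!mulnA -!expnMn.
rewrite [N * 2]mulnC [_ * 2]mulnC.
apply: leq_trans (leq_mul (subset_leq_card nonexp_sub) (leqnn _)) _.
apply: leq_trans (leq_mul (leq_card_bigcup _ _) (leqnn _)) _.
rewrite big_distrl /=.
apply: (@leq_trans (\sum_(Q | P Q) #|{ffun 'I_M -> {ffun 'I_4 -> Lit}}| * (2 * #|T|) ^ r)).
  by apply: leq_sum => Q /andP[_ /eqP <-]; apply: card_repeating.
by rewrite sum_nat_const mulnCA leq_mul2l leq_mul2r card_P !orbT.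
Qed.

Lemma leq_bin_exp (n k : nat) : k <= n -> 'C(n, k) <= 2 ^ n.
Proof.
move=> kn; rewrite -[2]/(1 + 1) expnDn (bigD1 (inord k)) //= inordK //.
by rewrite !exp1n !muln1 leq_addr.
Qed.

Lemma bin_expn_leq (m t : nat) : 'C(m, t) * t ^ t <= (4 * m) ^ t.
Proof.
have powE k : k ^ t = \prod_(i < t) k by rewrite prod_nat_const card_ord.
have t_le : t ^ t <= 4 ^ t * t`!.
  apply: (@leq_trans ('C(t + t, t) * t`!)); last first.
    rewrite leq_mul2r (_ : 4 ^ t = 2 ^ (t + t)).
      by rewrite leq_bin_exp ?leq_addr ?orbT.
    by rewrite expnD -expnMn.
  rewrite bin_ffact powE ffact_prod.
  by apply: leq_prod => i _; have := ltn_ord i; lia.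
apply: leq_trans (leq_mul (leqnn _) t_le) _.
rewrite mulnCA bin_ffact expnMn leq_mul2l; apply/orP; right.
rewrite powE ffact_prod.
by apply: leq_prod => i _; rewrite leq_subr.
Qed.

End Expansion.

Lemma union_term_le (R : realFieldType) (N C a t s : nat) :
  a = ((64 * C) ^ 2)%N ->
  (0 < N)%N -> (0 < C)%N -> (16 * a * s <= N)%N -> (0 < t <= s)%N ->
  'C(C * N, t)%:R * (16 ^ t)%:R * (t%:R / N%:R) ^+ (t + uphalf t)
    <= (16 * a)%:R / N%:R * (2%:R ^- t) :> R.
Proof.
move=> aE N_gt0 C_gt0 asN /andP[t_gt0 ts].
have N0 : 0 < N%:R :> R by rewrite ltr0n.
pose x : R := t%:R / N%:R; pose h := uphalf t.
have x_ge0 : 0 <= x by rewrite divr_ge0.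
have th : (t <= 2 * h)%N by rewrite /h uphalf_half; have := odd_double_half t; lia.
have h_gt0 : (0 < h)%N by lia.
have ax : a%:R * x <= 16^-1.
  have : (16 * (a * t) <= N)%N by apply: leq_trans asN; nia.
  rewrite -(ler_nat R) !natrM => atN; rewrite /x mulrA ler_pdivrMr //.
  by move: atN; move: (a%:R * t%:R) (N%:R) => ? ? ?; lra.
have head : 'C(C * N, t)%:R * (16 ^ t)%:R * x ^+ t <= a%:R ^+ h.
  rewrite expr_div_n -!natrX -natrM mulrA ler_pdivrMr ?ltr0n ?expn_gt0 ?N_gt0 //.
  rewrite -!natrM ler_nat.
  have := bin_expn_leq (C * N) t; set b := 'C(_, _) => b_le.
  apply: (@leq_trans (16 ^ t * (4 * (C * N)) ^ t)).
    by rewrite mulnAC mulnC leq_mul2l b_le orbT.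
  rewrite -expnMn (_ : 16 * (4 * (C * N)) = 64 * C * N)%N; last by lia.
  rewrite expnMn leq_mul2r aE -expnM leq_pexp2l ?orbT //; lia.
rewrite exprD mulrA.
apply: (@le_trans _ _ (a%:R ^+ h * x ^+ h)).
  by apply: ler_wpM2r; rewrite ?exprn_ge0.
rewrite -exprMn.
have step : (a%:R * x) ^+ h <= a%:R * x * 16 * 4 ^- t.
  have -> : (a%:R * x) ^+ h = a%:R * x * (a%:R * x) ^+ h.-1.
    by rewrite -exprS prednK.
  rewrite -[leRHS]mulrA; apply: ler_wpM2l; first by rewrite mulr_ge0.
  apply: (@le_trans _ _ (16^-1 ^+ h.-1)).
    by apply: lerXn2r; rewrite // nnegrE ?mulr_ge0 ?invr_ge0.
  rewrite exprVn ler_pdivlMr ?exprn_gt0 // [leLHS]mulrC ler_pdivrMr ?exprn_gt0 //.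
  rewrite -exprS prednK //.
  rewrite -!natrX ler_nat (_ : 16 = 4 ^ 2)%N // -expnM leq_pexp2l //.
apply: (le_trans step).
have t2 : t%:R <= 2 ^+ t :> R by rewrite -natrX ler_nat ltnW // ltn_expl.
have -> : a%:R * x * 16 * 4 ^- t = (16 * a)%:R / N%:R * (t%:R * 4 ^- t).
  by rewrite /x natrM; field; rewrite ?expf_neq0 ?gt_eqF.
rewrite ler_wpM2l ?divr_ge0 // ler_pdivrMr ?exprn_gt0 //.
by rewrite mulrC ler_pdivlMr ?exprn_gt0 // (_ : 4 = 2 * 2) ?exprMn ?ler_wpM2r ?exprn_ge0 //; ring.
Qed.

Lemma nonexpanding_prob (R : realFieldType) (N C M a s : nat) :
  a = ((64 * C) ^ 2)%N ->
  (0 < N)%N -> (0 < C)%N -> M = (C * N)%N -> (16 * a * s <= N)%N ->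
  #|[set f : {ffun 'I_M -> {ffun 'I_4 -> bool * 'I_N}} |
      [exists T : {set 'I_M}, (0 < #|T| <= s)%N && (#|span (scope f) T| < #|T|)%N]]|%:R
  <= #|{ffun 'I_M -> {ffun 'I_4 -> bool * 'I_N}}|%:R * ((16 * a)%:R / N%:R) :> R.
Proof.
move=> aE N_gt0 C_gt0 MCN asN; subst M; set Omega := #|{ffun 'I_(C * N) -> _}|.
have N0 : 0 < N%:R :> R by rewrite ltr0n.
pose P (T : {set 'I_(C * N)}) := (0 < #|T| <= s)%N.
pose g (t : nat) : R := (16 ^ t)%:R * (t%:R / N%:R) ^+ (t + uphalf t).
apply: (@le_trans _ _ (\sum_(T | P T) Omega%:R * g #|T|)).
  apply: (@le_trans _ _ (\sum_(T | P T) #|[set f : {ffun 'I_(C * N) ->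
      {ffun 'I_4 -> bool * 'I_N}} | (#|span (scope f) T| < #|T|)%N]|%:R)).
    rewrite -natr_sum ler_nat; apply: leq_trans (leq_card_bigcup _ _).
    apply/subset_leq_card/subsetP => f; rewrite inE => /existsP[T /andP[PT fT]].
    by apply/bigcupP; exists T => //; rewrite inE.
  apply: ler_sum => T _.
  have := @card_nonexpanding N (C * N) T _ (erefl _).
  rewrite -/Omega -(ler_nat R) !natrM -ler_pdivlMr ?ltr0n ?expn_gt0 ?N_gt0 //.
  by rewrite /g expr_div_n !natrX !mulrA.
rewrite -mulr_sumr ler_wpM2l //.
rewrite (partition_big (fun T : {set 'I_(C * N)} => inord #|T| : 'I_s.+1) (fun t => 0 < t)%N) /=; last first.
  by move=> T /andP[T_gt0 Ts]; rewrite inordK.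
apply: (@le_trans _ _ (\sum_(t < s.+1 | (0 < t)%N) ((16 * a)%:R / N%:R * (2%:R ^- t)))).
  apply: ler_sum => t t_gt0.
  have /(union_term_le R aE N_gt0 C_gt0 asN) : (0 < t <= s)%N by rewrite t_gt0 -ltnS ltn_ord.
  apply: le_trans.
  rewrite -mulrA -/(g t) -[X in 'C(X, _)](card_ord (C * N)) -card_draws.
  rewrite mulr_natl -sumr_const.
  rewrite [X in _ <= X](eq_bigl (fun T : {set 'I_(C * N)} => #|T| == t)); last first.
    by move=> T; rewrite inE.
  rewrite [X in X <= _](eq_bigl (fun T : {set 'I_(C * N)} => #|T| == t)).
    by rewrite le_eqVlt; apply/orP; left; apply/eqP/eq_bigr => T /eqP->.
  move=> T; apply/andP/eqP => [[/andP[_ Ts] /eqP <-]|Tt]; first by rewrite inordK.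
  rewrite /P Tt t_gt0 -ltnS ltn_ord; split => //; apply/eqP/val_inj.
  by rewrite /= inordK.
rewrite -mulr_sumr -[leRHS]mulr1 ler_wpM2l ?divr_ge0 //.
have sum2 : forall k, \sum_(t < k.+1 | (0 < t)%N) (2%:R ^- t : R) = 1 - 2 ^- k.
  elim=> [|k IHk]; first by rewrite big_mkcond big_ord1 /= expr0 invr1 subrr.
  rewrite big_mkcond big_ord_recr -big_mkcond /= IHk exprS.
  by have : 2 ^+ k != 0 :> R; [rewrite expf_neq0 // pnatr_eq0 | move: (2 ^+ k) => z z0; field].
by rewrite sum2 lerBlDr lerDl invr_ge0 exprn_ge0.
Qed.

(** * The gadget graph *)

Section Instances.
Local Open Scope nat_scope.

Definition to_edge n (e : nat * nat) : option ('I_n * 'I_n) :=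
  if insub e.1 is Some a then
    if insub e.2 is Some b then Some (a, b) else None
  else None.

Definition to_instance n (s : seq (nat * nat)) : instance n :=
  Instance (filter_all (fun e => e.1 != e.2) (pmap (@to_edge n) s)).

Lemma to_instanceE n (s : seq (nat * nat)) :
  all (fun e => [&& e.1 < n, e.2 < n & e.1 != e.2]) s ->
  [seq (val e.1, val e.2) | e <- edges (to_instance n s)] = s.
Proof.
rewrite /=; elim: s => //= -[a b] s IHs /andP[/and3P[/= an bn ab] /IHs sE].
rewrite /to_edge /= !insubT /= -(inj_eq val_inj) /= ab /=.
by congr (_ :: _); exact: sE.
Qed.

(* Vertices below n/2 are the K copies of the 4 N variables, one auxiliary
   vertex per constraint and a few isolated vertices; [mirror] exchanges each
   of them with its negation. *)
Definition mirror n w := n - w.+1.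
Definition var_vertex N i v k := (4 * k + i) * N + v.
Definition lit_vertex n N i k (l : bool * nat) :=
  if l.1 then mirror n (var_vertex N i l.2 k) else var_vertex N i l.2 k.
Definition aux_vertex N K j := 4 * K * N + j.

(* The two copies of the edge between vertices 0 and 4 N, which carry the same
   variable, are never cut by the pseudo-distribution; they bring the value
   from 3/4 down to 3/4 - 1/(4c). *)
Definition unit_edges c n N a w : seq (nat * nat) :=
  nseq (3 * c - 1) (a, w) ++ nseq (3 * c - 1) (mirror n a, mirror n w)
  ++ nseq 2 (0, 4 * N).

Definition lit_edges c n N K a i (l : bool * nat) : seq (nat * nat) :=
  flatten [seq unit_edges c n N a (lit_vertex n N i k l) | k <- iota 0 K].

Definition clause_edges c n N K a (lits : nat -> bool * nat) : seq (nat * nat) :=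
  flatten [seq lit_edges c n N K a i (lits i) | i <- iota 0 4].

Definition raw_edges c n N K M (lits : nat -> nat -> bool * nat) : seq (nat * nat) :=
  flatten [seq clause_edges c n N K (aux_vertex N K j) (lits j) | j <- iota 0 M].

Lemma sum_raw_edges (V : nmodType) (F : nat * nat -> V) c n N K M lits :
  (\sum_(e <- raw_edges c n N K M lits) F e = \sum_(j < M) \sum_(i < 4) \sum_(k < K)
    (F (aux_vertex N K j, lit_vertex n N i k (lits j i)) *+ (3 * c - 1) +
     F (mirror n (aux_vertex N K j), mirror n (lit_vertex n N i k (lits j i))) *+ (3 * c - 1) +
     F (0, 4 * N) *+ 2))%R.
Proof.
rewrite big_flatten big_map -{1}[M]subn0 -/(index_iota 0 M) big_mkord.
apply: eq_bigr => j _; rewrite big_flatten big_map -[iota 0 4]/(index_iota 0 4) big_mkord.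
apply: eq_bigr => i _; rewrite big_flatten big_map -{1}[K]subn0 -/(index_iota 0 K) big_mkord.
by apply: eq_bigr => k _; rewrite !big_cat !big_nseq !iter_addr_0 /= addrA.
Qed.

Lemma size_raw_edges c n N K M lits : 0 < c ->
  size (raw_edges c n N K M lits) = 24 * c * K * M.
Proof.
move=> c_gt0; have natmul m : (1 *+ m)%R = m :> nat by rewrite -[RHS]natn.
rewrite -sum1_size (sum_raw_edges (V := nat) (fun=> 1)).
rewrite (eq_bigr (fun=> 24 * c * K)); first by rewrite sum_nat_const card_ord mulnC.
move=> j _; rewrite (eq_bigr (fun=> 6 * c * K)).
  by rewrite sum_nat_const card_ord; lia.
move=> i _; rewrite (eq_bigr (fun=> 6 * c)).
  by rewrite sum_nat_const card_ord; lia.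
by move=> k _; rewrite !natmul /GRing.add /=; lia.
Qed.

End Instances.

(** * The SOS solution *)

Section FourTerms.
Variables (R : nzRingType) (F : 'I_4 -> R).

Lemma sum4 : \sum_i F i = F (inord 0) + F (inord 1) + F (inord 2) + F (inord 3).
Proof.
rewrite !big_ord_recl big_ord0 addr0 !addrA.
by congr (F _ + F _ + F _ + F _); apply: val_inj; rewrite /= inordK.
Qed.

Lemma prod4 : \prod_i F i = F (inord 0) * F (inord 1) * F (inord 2) * F (inord 3).
Proof.
rewrite !big_ord_recl big_ord0 mulr1 !mulrA.
by congr (F _ * F _ * F _ * F _); apply: val_inj; rewrite /= inordK.
Qed.

End FourTerms.

Section Vertices.
Variables (c n N K M : nat).
Variables (f : {ffun 'I_M -> {ffun 'I_4 -> bool * 'I_N}}) (lits : nat -> nat -> bool * nat).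
Hypothesis lits_f : forall (j : 'I_M) (i : 'I_4), lits j i = ((f j i).1, val (f j i).2).
Hypothesis N_gt0 : (0 < N)%N.
Hypothesis K_ge2 : (1 < K)%N.
Hypothesis n_ge : (2 * (4 * K * N + M) <= n)%N.

Lemma aux_vertex_lt (j : 'I_M) : (aux_vertex N K j < n)%N.
Proof. by rewrite /aux_vertex; have := ltn_ord j; lia. Qed.

Lemma lit_vertex_lt (j : 'I_M) (i : 'I_4) (k : 'I_K) :
  (lit_vertex n N i k (lits j i) < n)%N.
Proof.
rewrite lits_f /lit_vertex /var_vertex /mirror /=.
have := ltn_ord (f j i).2; have := ltn_ord i; have := ltn_ord k => *.
by case: ifP => _; nia.
Qed.

Lemma raw_edges_valid : all (fun e => [&& e.1 < n, e.2 < n & e.1 != e.2])%N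
  (raw_edges c n N K M lits).
Proof.
apply/allP => e /flattenP[_ /mapP[j jM ->]] /flattenP[_ /mapP[i i4 ->]].
move=> /flattenP[_ /mapP[k kK ->]]; move: jM i4 kK; rewrite !mem_iota !add0n => jM i4 kK.
have := aux_vertex_lt (Ordinal jM).
have /= := lit_vertex_lt (Ordinal jM) (Ordinal i4) (Ordinal kK).
have neq : aux_vertex N K j != lit_vertex n N i k (lits j i).
  have := lits_f (Ordinal jM) (Ordinal i4) => /= ->.
  rewrite /aux_vertex /lit_vertex /var_vertex /mirror /=.
  have := ltn_ord (f (Ordinal jM) (Ordinal i4)).2.
  by case: ifP => _ *; nia.
move: neq; set w := lit_vertex _ _ _ _ _; set a := aux_vertex _ _ _ => aw wn an.
rewrite !mem_cat !mem_nseq.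
case/or3P => /andP[_ /eqP->] /=; first by rewrite an wn aw.
  by rewrite /mirror; lia.
by apply/and3P; split; nia.
Qed.

End Vertices.

Section Pseudoexpectation.
Variables (R : realType) (c n N K M d : nat).
Variables (f : {ffun 'I_M -> {ffun 'I_4 -> bool * 'I_N}}) (lits : nat -> nat -> bool * nat).
Hypothesis lits_f : forall (j : 'I_M) (i : 'I_4), lits j i = ((f j i).1, val (f j i).2).
Hypothesis c_gt0 : (0 < c)%N.
Hypothesis N_gt0 : (0 < N)%N.
Hypothesis M_gt0 : (0 < M)%N.
Hypothesis K_ge2 : (1 < K)%N.
Hypothesis n_ge : (2 * (4 * K * N + M) <= n)%N.
Hypothesis n_even : ~~ odd n.
Hypothesis d_ge4 : (4 <= d)%N.
Hypothesis expansion : forall T : {set 'I_M},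
  (0 < #|T| <= 3 * d)%N -> (#|T| <= #|span (scope f) T|)%N.

Local Notation V := ('I_4 * 'I_N)%type.
Local Notation point := {ffun V -> bool}.
Local Notation sgn b := ((-1) ^+ nat_of_bool b : R).

Definition lit_value (j : 'I_M) i (x : point) : R := sgn (f j i).1 * sgn (x (i, (f j i).2)).

Definition lit_sum j x : R := \sum_i lit_value j i x.

Definition clause_sign (j : 'I_M) : R := - \prod_i sgn (f j i).1.

Definition vertex_var (w : nat) : V :=
  (Ordinal (ltn_pmod (w %/ N) (isT : 0 < 4)%N), Ordinal (ltn_pmod w N_gt0)).

Definition half_value (w : nat) (x : point) : R :=
  if (w < 4 * K * N)%N then sgn (x (vertex_var w))
  else if (insub (w - 4 * K * N)%N : option 'I_M) is Some j then - lit_sum j x / 2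
  else 1.

Definition vertex_value (w : nat) (x : point) : R :=
  if (2 * w < n)%N then half_value w x else - half_value (mirror n w) x.

Lemma vertex_value_mirror w x : (w < n)%N ->
  vertex_value (mirror n w) x = - vertex_value w x.
Proof.
move=> wn; rewrite /vertex_value /mirror.
have nE := odd_double_half n; rewrite (negPf n_even) add0n in nE.
case: ifP => h1; case: ifP => h2; rewrite ?opprK //; first by lia.
  by congr (- half_value _ _); lia.
by lia.
Qed.

Lemma vertex_value_lit (j : 'I_M) (i : 'I_4) (k : 'I_K) x :
  vertex_value (lit_vertex n N i k (lits j i)) x = lit_value j i x.
Proof.
have vK : (var_vertex N i (f j i).2 k < 4 * K * N)%N.
  rewrite /var_vertex; have := ltn_ord (f j i).2; have := ltn_ord i; have := ltn_ord k; nia.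
have varE : vertex_value (var_vertex N i (f j i).2 k) x = sgn (x (i, (f j i).2)).
  rewrite /vertex_value ifT; last by lia.
  rewrite /half_value vK; congr (sgn (x _)); congr (_, _); apply: val_inj => /=.
    by rewrite /var_vertex divnMDl // divn_small // addn0 mulnC modnMDl modn_small.
  by rewrite /var_vertex modnMDl modn_small.
rewrite lits_f /lit_vertex /lit_value /=; case: (f j i).1.
  by rewrite vertex_value_mirror ?varE ?expr1 ?mulN1r //; lia.
by rewrite varE expr0 mul1r.
Qed.

Lemma vertex_value_aux (j : 'I_M) x :
  vertex_value (aux_vertex N K j) x = - lit_sum j x / 2.
Proof.
have jM := ltn_ord j; rewrite /vertex_value /aux_vertex ifT; last by lia.
rewrite /half_value ifF; last by lia.
by rewrite addKn insubT /=; congr (- lit_sum _ _ / 2); apply: val_inj.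
Qed.

Lemma lit_value_sqr j i x : lit_value j i x ^+ 2 = 1.
Proof. by rewrite exprMn !sqrr_sign mulr1. Qed.

Lemma clause_sign_sqr j : clause_sign j ^+ 2 = 1.
Proof. by rewrite sqrrN -prodrXl big1 // => i _; rewrite sqrr_sign. Qed.

Lemma clause_litE j x :
  clause (scope f) clause_sign j x = - \prod_i lit_value j i x.
Proof.
rewrite /clause /clause_sign mulNr /chi big_imset /= => [|i i' _ _ [] //].
by rewrite -big_split.
Qed.

Local Notation E0 := (@xorE R V 'I_M (scope f) clause_sign d).

Lemma lowdeg_lit j i : lowdeg 1 (lit_value j i).
Proof.
apply: lowdegZ; apply: eq_lowdeg (lowdeg_chi R (A := [set (i, (f j i).2)]) _).
  by move=> x; rewrite chi1.
by rewrite cards1.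
Qed.

Lemma lowdeg_vertex w : lowdeg 1 (vertex_value w).
Proof.
have lhalf v : lowdeg 1 (half_value v).
  case: (ltnP v (4 * K * N)) => vK.
    apply: eq_lowdeg (lowdeg_chi R (A := [set vertex_var v]) _).
      by move=> x; rewrite chi1 /half_value vK.
    by rewrite cards1.
  case Ej: (insub (v - 4 * K * N)%N : option 'I_M) => [j|]; last first.
    by apply: eq_lowdeg (lowdeg_cst _ _ 1) => x; rewrite /half_value ltnNge vK Ej.
  apply: (@eq_lowdeg _ _ _ (fun x => (- 2^-1) * lit_sum j x)).
    by move=> x; rewrite /half_value ltnNge vK Ej mulNr mulrC mulNr.
  by apply: lowdegZ; apply: lowdeg_sum => i _; exact: lowdeg_lit.
case w2: (2 * w < n)%N.
  by apply: eq_lowdeg (lhalf w) => x; rewrite /vertex_value w2.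
apply: eq_lowdeg (lowdegZ (-1) (lhalf (mirror n w))) => x.
by rewrite mulN1r /vertex_value w2.
Qed.

Definition vanishes (phi : point -> R) : Prop :=
  forall g, lowdeg (d - 2) g -> E0 (fun x => phi x * g x) = 0.

Lemma eq_vanishes phi psi : phi =1 psi -> vanishes phi -> vanishes psi.
Proof.
move=> eq0 phi0 g lg; rewrite -[RHS](phi0 g lg).
by apply: eq_xorE => x; rewrite eq0.
Qed.

Lemma vanishesZ a phi : vanishes phi -> vanishes (fun x => a * phi x).
Proof.
move=> phi0 g lg; rewrite -[RHS](mulr0 a) -(phi0 g lg) -xorEZ.
by apply: eq_xorE => x; rewrite mulrA.
Qed.

Lemma vanishes_sum (I : Type) (s : seq I) (P : pred I) (F : I -> point -> R) :
  (forall i, P i -> vanishes (F i)) -> vanishes (fun x => \sum_(i <- s | P i) F i x).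
Proof.
move=> F0 g lg; transitivity (\sum_(i <- s | P i) E0 (fun x => F i x * g x)).
  by rewrite -xorE_sum; apply: eq_xorE => x; rewrite mulr_suml.
by rewrite big1 // => i Pi; exact: F0.
Qed.

Lemma vanishes_lit_sum j : vanishes (fun x => lit_sum j x ^+ 2 - 4).
Proof.
move=> g lg.
pose l (i : nat) x : R := lit_value j (inord i) x.
pose p x : R := l 2%N x * l 3%N x + l 1%N x * l 3%N x + l 1%N x * l 2%N x.
have lp : lowdeg 2 p.
  have ll i i' : lowdeg 2 (fun x => l i x * l i' x).
    exact: (lowdegM (lowdeg_lit _ _) (lowdeg_lit _ _)).
  by do 2! [apply: lowdegD => //].
have lpg : lowdeg d (fun x => p x * g x).
  by apply: lowdeg_leq (lowdegM lp lg); lia.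
rewrite (@eq_xorE _ _ _ _ _ _ _ (fun x => 2 * (p x * g x) +
   (-2) * (clause (scope f) clause_sign j x * (p x * g x)))).
  have := xorE_clauses clause_sign_sqr expansion lpg (S := [set j]).
  rewrite cards1 => /(_ (leq_trans (isT : 0 < 4)%N d_ge4)).
  under eq_xorE => x do rewrite /clauses big_set1.
  by move=> eqE; rewrite xorE_lin xorEZ eqE; ring.
move=> x; rewrite clause_litE /lit_sum sum4 prod4 /p /l.
have := lit_value_sqr j (inord 3) x; have := lit_value_sqr j (inord 2) x.
have := lit_value_sqr j (inord 1) x; have := lit_value_sqr j (inord 0) x.
move: (lit_value j (inord 0) x) (lit_value j (inord 1) x) (lit_value j (inord 2) x)
  (lit_value j (inord 3) x) => a0 a1 a2 a3 e0 e1 e2 e3.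
have -> : (a0 + a1 + a2 + a3) ^+ 2 - 4 = (a0 ^+ 2 - 1) + (a1 ^+ 2 - 1) + (a2 ^+ 2 - 1) +
  (a3 ^+ 2 - 1) + 2 * (a0 * a1 + a0 * a2 + a0 * a3) + 2 * (a2 * a3 + a1 * a3 + a1 * a2) by ring.
have -> : a0 * a1 + a0 * a2 + a0 * a3 = a0 * a1 * a2 * a3 * (a2 * a3 + a1 * a3 + a1 * a2).
  transitivity (a0 * a1 * a2 ^+ 2 * a3 ^+ 2 + a0 * a2 * a1 ^+ 2 * a3 ^+ 2 + a0 * a3 * a1 ^+ 2 * a2 ^+ 2); last by ring.
  by rewrite e1 e2 e3 !mulr1.
by rewrite e0 e1 e2 e3; ring.
Qed.

Lemma vanishes_vertex w : vanishes (fun x => vertex_value w x ^+ 2 - 1).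
Proof.
have hvan v : vanishes (fun x => half_value v x ^+ 2 - 1).
  have van0 : vanishes (fun=> 0).
    by move=> g _; rewrite -[RHS](@xorE0 R V 'I_M (scope f) clause_sign d);
      apply: eq_xorE => x; rewrite mul0r.
  case: (ltnP v (4 * K * N)) => vK.
    by apply: eq_vanishes van0 => x; rewrite /half_value vK sqrr_sign subrr.
  case Ej: (insub (v - 4 * K * N)%N : option 'I_M) => [j|]; last first.
    by apply: eq_vanishes van0 => x; rewrite /half_value ltnNge vK Ej expr1n subrr.
  apply: eq_vanishes (vanishesZ 4^-1 (vanishes_lit_sum j)) => x.
  by rewrite /half_value ltnNge vK Ej /=; field.
case w2: (2 * w < n)%N.
  by apply: eq_vanishes (hvan w) => x; rewrite /vertex_value w2.
by apply: eq_vanishes (hvan (mirror n w)) => x; rewrite /vertex_value w2 sqrrN.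
Qed.

Let G := to_instance n (raw_edges c n N K M lits).

Definition value_poly (p : {mpoly R[n]}) (x : point) : R :=
  p.@[fun w => vertex_value w x].

Lemma lowdeg_value_poly p k : (total_degree p <= k)%N -> lowdeg k (value_poly p).
Proof.
rewrite /total_degree => pk; apply: (@eq_lowdeg _ _ _ (fun x =>
  \sum_(m <- msupp p) p@_m * \prod_(i < n) vertex_value i x ^+ m i)).
  by move=> x; rewrite /value_poly mevalE.
rewrite [X in lowdeg k X](_ : _ = fun x => \sum_(m <- msupp p | m \in msupp p)
    p@_m * \prod_(i < n) vertex_value i x ^+ m i); last first.
  by apply/boolp.funext => x; rewrite -big_seq.
apply: lowdeg_sum => m mp; apply: lowdegZ.
have lm : lowdeg (\sum_(i < n) m i) (fun x => \prod_(i < n) vertex_value i x ^+ m i).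
  apply: lowdeg_prod => i.
  by have := lowdegX (m i) (lowdeg_vertex i); rewrite mul1n.
by apply: lowdeg_leq lm; rewrite -mdegE; have := msize_mdeg_lt mp; lia.
Qed.

Definition gadgetE (p : {mpoly R[n]}) : R := E0 (value_poly p).

Lemma value_objectiveE x : value_poly (objective_poly R G) x =
  (3 / 4 - 1 / (4 * c)%:R) + (3 * c - 1)%:R / (24 * c * M)%:R * \sum_j (lit_sum j x ^+ 2 - 4).
Proof.
rewrite /value_poly /objective_poly mevalZ.
have rawE : [seq (val e.1, val e.2) | e <- edges G] = raw_edges c n N K M lits.
  exact: to_instanceE (raw_edges_valid c lits_f N_gt0 K_ge2 n_ge).
have -> : size (edges G) = (24 * c * K * M)%N.
  by rewrite -(size_raw_edges n N K M lits c_gt0) -rawE size_map.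
rewrite raddf_sum /=.
pose F (e : nat * nat) : R := 4^-1 * (vertex_value e.1 x - vertex_value e.2 x) ^+ 2.
rewrite (eq_bigr (fun e => F (val e.1, val e.2))); last first.
  by move=> e _; rewrite mevalZ rmorphXn /= mevalB !mevalXU.
rewrite -(big_map (fun e => (val e.1, val e.2)) xpredT F) rawE.
have aux_lt (j : 'I_M) : (aux_vertex N K j < n)%N by exact: aux_vertex_lt.
have lit_lt (j : 'I_M) (i : 'I_4) (k : 'I_K) : (lit_vertex n N i k (lits j i) < n)%N.
  exact: lit_vertex_lt.
rewrite sum_raw_edges.
have clauseE (j : 'I_M) : \sum_(i < 4) \sum_(k < K)
    (F (aux_vertex N K j, lit_vertex n N i k (lits j i)) *+ (3 * c - 1) +
     F (mirror n (aux_vertex N K j), mirror n (lit_vertex n N i k (lits j i))) *+ (3 * c - 1) +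
     F (0, 4 * N)%N *+ 2) = (2 * (3 * c - 1) * K)%:R * (3 + (lit_sum j x ^+ 2 - 4) / 2).
  transitivity (\sum_(i < 4) (2 * (3 * c - 1) * K)%:R *
      (4^-1 * (lit_sum j x ^+ 2 / 4 + 1 + lit_sum j x * lit_value j i x))).
    apply: eq_bigr => i _.
    rewrite (eq_bigr (fun=> (2 * (3 * c - 1))%:R *
      (4^-1 * (lit_sum j x ^+ 2 / 4 + 1 + lit_sum j x * lit_value j i x)))).
      by rewrite sumr_const card_ord -[_ *+ K]mulr_natl mulrA -natrM mulnC.
    move=> k _; rewrite /F /= !vertex_value_mirror ?aux_lt ?lit_lt //.
    rewrite vertex_value_lit vertex_value_aux.
    have -> : vertex_value 0 x = vertex_value (4 * N) x.
      rewrite /vertex_value !ifT; [|by nia..].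
      rewrite /half_value !ifT; [|by nia..].
      congr (sgn (x _)); congr (_, _); apply: val_inj => /=.
        by rewrite div0n mulnK.
      by rewrite mod0n modnMl.
    rewrite subrr expr0n /= mulr0 mul0rn addr0 -mulrnDl -[_ *+ (3 * c - 1)]mulr_natl natrM.
    have -> : lit_sum j x ^+ 2 / 4 + 1 + lit_sum j x * lit_value j i x
        = (lit_sum j x / 2 + lit_value j i x) ^+ 2.
      by rewrite sqrrD lit_value_sqr; field.
    by field.
  rewrite -mulr_sumr; congr (_ * _); rewrite -mulr_sumr big_split /= -mulr_sumr -/(lit_sum j x).
  by rewrite sumr_const card_ord; field.
rewrite (eq_bigr _ (fun j _ => clauseE j)) -mulr_sumr big_split /= -mulr_suml.
rewrite sumr_const card_ord -[3 *+ M]mulr_natl.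
have c0 : c%:R != 0 :> R by rewrite pnatr_eq0; lia.
have K0 : K%:R != 0 :> R by rewrite pnatr_eq0; lia.
have M0 : M%:R != 0 :> R by rewrite pnatr_eq0; lia.
have -> : (3 * c - 1)%:R = 3 * c%:R - 1 :> R by rewrite natrB ?natrM //; lia.
rewrite !natrM (_ : (3 * c - 1)%:R = 3 * c%:R - 1); last by rewrite natrB ?natrM //; lia.
by field; rewrite c0 K0 M0.
Qed.

Lemma gadget_sos_solution :
  sos_solution d G (3 / 4 - 1 / (4 * c)%:R) gadgetE.
Proof.
have E01 : E0 (fun=> 1) = 1 by apply: xorE1.
have vertex0 x : \sum_(w < n) vertex_value w x = 0.
  have : \sum_(w < n) vertex_value w x = - \sum_(w < n) vertex_value w x.
    rewrite [LHS](reindex_inj rev_ord_inj) /= -sumrN; apply: eq_bigr => w _.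
    by rewrite -vertex_value_mirror.
  by move=> h; lra.
split; first split.
- split.
  + move=> a p q _ _; rewrite /gadgetE -xorE_lin; apply: eq_xorE => x.
    by rewrite /value_poly mevalD mevalZ.
  + by rewrite -[RHS]E01; apply: eq_xorE => x; rewrite /value_poly meval1.
  + move=> v q qd; have lq : lowdeg (d - 2) (value_poly q) by apply: lowdeg_value_poly; lia.
    apply/eqP; rewrite -subr_eq0 -mulN1r addrC -xorE_lin -[X in _ == X](vanishes_vertex v lq).
    apply/eqP; apply: eq_xorE => x; rewrite /value_poly mevalM rmorphXn /= mevalXU.
    by ring.
  + move=> q qd; rewrite /gadgetE.
    rewrite (@eq_xorE _ _ _ _ _ _ _ (fun x => value_poly q x ^+ 2)).
      exact: (xorE_sqr_ge0 clause_sign_sqr expansion qd (lowdeg_value_poly (leqnn _))).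
    by move=> x; rewrite /value_poly rmorphXn.
- have bis0 x : value_poly (bisection_poly R n) x = 0.
    by rewrite /value_poly raddf_sum -[RHS](vertex0 x); apply: eq_bigr => w _; rewrite /= mevalXU.
  have E00 : E0 (fun=> 0) = 0 by exact: xorE0.
  split; rewrite ?expr0n -[RHS]E00; apply: eq_xorE => x; first exact: bis0.
  by rewrite /value_poly rmorphXn /= -/(value_poly _ x) bis0 expr0n.
set beta := 3 / 4 - _; pose H := value_poly (objective_poly R G).
have vanH : vanishes (fun x => H x - beta).
  have van : vanishes (fun x => \sum_j (lit_sum j x ^+ 2 - 4)).
    by apply: vanishes_sum => j _; exact: vanishes_lit_sum.
  apply: eq_vanishes (vanishesZ ((3 * c - 1)%:R / (24 * c * M)%:R) van) => x.
  by rewrite /H value_objectiveE -/beta; ring.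
have lH : lowdeg 2 H.
  apply: (@eq_lowdeg _ _ _ (fun x => beta +
     (3 * c - 1)%:R / (24 * c * M)%:R * \sum_j (lit_sum j x ^+ 2 - 4))).
    by move=> x; rewrite /H value_objectiveE.
  apply: lowdegD; first exact: lowdeg_cst.
  apply: lowdegZ; apply: lowdeg_sum => j _; apply: lowdegD; last exact: lowdeg_cst.
  rewrite -[X in lowdeg X]mul1n; apply: lowdegX; apply: lowdeg_sum => i _; exact: lowdeg_lit.
have EH g : lowdeg (d - 2) g -> E0 (fun x => H x * g x) = beta * E0 g.
  move=> lg; apply/eqP; rewrite -subr_eq0 -mulNr addrC -xorE_lin -[X in _ == X](vanH _ lg).
  by apply/eqP; apply: eq_xorE => x; ring.
have EHbeta : gadgetE (objective_poly R G) = beta.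
  rewrite -[RHS]mulr1 -E01 -EH; last exact: lowdeg_cst.
  by apply: eq_xorE => x; rewrite mulr1.
split => //; transitivity (E0 (fun x => H x * H x)).
  by apply: eq_xorE => x; rewrite /H /value_poly rmorphXn /= expr2.
rewrite EH; last by apply: lowdeg_leq lH; lia.
by rewrite [E0 H]EHbeta expr2.
Qed.

End Pseudoexpectation.

(** * Genuine bisections *)

Lemma sum_ord_mul (V : nmodType) (A B : nat) (F : nat -> V) :
  \sum_(w < A * B) F w = \sum_(a < A) \sum_(b < B) F (a * B + b)%N.
Proof.
elim: A => [|A IHA]; first by rewrite !big_ord0.
rewrite mulSn addnC big_ord_recr /= -IHA -!(big_mkord xpredT).
rewrite (big_cat_nat (leq0n (A * B)) (leq_addr B (A * B))) /=; congr (_ + _).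
rewrite -{1}[(A * B)%N]add0n big_addn addKn big_mkord.
by apply: eq_bigr => b _; rewrite addnC.
Qed.

(* The right-hand side is the multilinear extension of |y0 + y1 + y2 + y3| from
   {-1, 1}^4 to [-1, 1]^4. *)
Lemma multiaffine_ineq (R : realFieldType) (b y0 y1 y2 y3 : R) :
  `|b| = 1 -> `|y0| <= 1 -> `|y1| <= 1 -> `|y2| <= 1 -> `|y3| <= 1 ->
  b * (y0 + y1 + y2 + y3) <= 3 / 2 + (y0 * y1 + y0 * y2 + y0 * y3 + y1 * y2 +
    y1 * y3 + y2 * y3 - y0 * y1 * y2 * y3) / 2.
Proof.
move=> b1 h0 h1 h2 h3; rewrite -subr_ge0.
pose G z0 z1 z2 z3 : R := 3 / 2 + (z0 * z1 + z0 * z2 + z0 * z3 + z1 * z2 + z1 * z3 +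
  z2 * z3 - z0 * z1 * z2 * z3) / 2 - b * (z0 + z1 + z2 + z3).
have affine (g : R -> R) y : (forall z, g z = (g 1 + g (-1)) / 2 + (g 1 - g (-1)) / 2 * z) ->
    `|y| <= 1 -> 0 <= g 1 -> 0 <= g (-1) -> 0 <= g y.
  move=> gE; rewrite ler_norml => /andP[? ?] ? ?; rewrite (gE y).
  rewrite (_ : _ + _ = g 1 * ((1 + y) / 2) + g (-1) * ((1 - y) / 2)); last by field.
  by rewrite addr_ge0 // mulr_ge0 //; lra.
have s3 p q r : 0 <= G p q r 1 -> 0 <= G p q r (-1) -> 0 <= G p q r y3.
  by apply: affine => // z; rewrite /G; field.
have s2 p q : 0 <= G p q 1 y3 -> 0 <= G p q (-1) y3 -> 0 <= G p q y2 y3.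
  by apply: (affine (fun z => G p q z y3)) => // z; rewrite /G; field.
have s1 p : 0 <= G p 1 y2 y3 -> 0 <= G p (-1) y2 y3 -> 0 <= G p y1 y2 y3.
  by apply: (affine (fun z => G p z y2 y3)) => // z; rewrite /G; field.
have s0 : 0 <= G 1 y1 y2 y3 -> 0 <= G (-1) y1 y2 y3 -> 0 <= G y0 y1 y2 y3.
  by apply: (affine (fun z => G z y1 y2 y3)) => // z; rewrite /G; field.
have : -1 <= b <= 1 by rewrite -ler_norml b1.
move=> /andP[? ?].
by apply: s0; apply: s1; apply: s2; apply: s3; rewrite /G; lra.
Qed.

Lemma mean_value_bound (R : realFieldType) (m0 m1 m2 m3 : R) :
  `|m0| <= 1 -> `|m1| <= 1 -> `|m2| <= 1 -> `|m3| <= 1 ->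
  m0 * m1 + m0 * m2 + m0 * m3 + m1 * m2 + m1 * m3 + m2 * m3 - m0 * m1 * m2 * m3
    <= (m0 + m1 + m2 + m3) ^+ 2 / 2.
Proof.
move=> h0 h1 h2 h3.
suff : - (m0 * m1 * m2 * m3) <= (m0 ^+ 2 + m1 ^+ 2) / 2.
  have := sqr_ge0 m2; have := sqr_ge0 m3 => *.
  have -> : (m0 + m1 + m2 + m3) ^+ 2 / 2 = (m0 ^+ 2 + m1 ^+ 2) / 2 + m2 ^+ 2 / 2 + m3 ^+ 2 / 2 +
    (m0 * m1 + m0 * m2 + m0 * m3 + m1 * m2 + m1 * m3 + m2 * m3) by field.
  by lra.
apply: (@le_trans _ _ (`|m0| * `|m1|)).
  apply: (le_trans (ler_norm _)); rewrite normrN !normrM -mulrA.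
  by rewrite ler_piMr ?mulr_ge0 ?mulr_ile1.
rewrite -[m0 ^+ 2]real_normK ?num_real // -[m1 ^+ 2]real_normK ?num_real //.
by have := sqr_ge0 (`|m0| - `|m1|); rewrite sqrrB; lra.
Qed.

Section Soundness.
Variables (R : realType) (c n N K M lo : nat).
Variables (f : {ffun 'I_M -> {ffun 'I_4 -> bool * 'I_N}}) (lits : nat -> nat -> bool * nat).
Hypothesis lits_f : forall (j : 'I_M) (i : 'I_4), lits j i = ((f j i).1, val (f j i).2).
Hypothesis c_gt0 : (0 < c)%N.
Hypothesis N_gt0 : (0 < N)%N.
Hypothesis M_gt0 : (0 < M)%N.
Hypothesis K_gt0 : (0 < K)%N.
Hypothesis n_eq : (n = 2 * (4 * K * N + M + lo))%N.
Hypothesis few_others : (c * (M + lo) <= K * N)%N.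
Hypothesis disc_le : forall y : 'I_4 -> bool * 'I_N -> R,
  (forall i l, `|y i l| <= 1) -> discrepancy f y <= M%:R / (6 * c)%:R.
Variable s : nat -> R.
Hypothesis s_norm : forall w, `|s w| = 1.
Hypothesis s_sum0 : \sum_(w < n) s w = 0.
Local Notation Lit := (bool * 'I_N)%type.

Definition lit_mean (i : 'I_4) (l : Lit) : R :=
  (\sum_(k < K) s (lit_vertex n N i k (l.1, val l.2))) / K%:R.

Lemma lit_mean_le1 i l : `|lit_mean i l| <= 1.
Proof.
rewrite normrM normfV normr_nat ler_pdivrMr ?ltr0n // mul1r.
apply: (le_trans (ler_norm_sum _ _ _)).
by rewrite (eq_bigr (fun=> 1)) ?sumr_const ?card_ord // => k _; exact: s_norm.
Qed.

Definition neg_lit (l : Lit) : Lit := (~~ l.1, l.2).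

Lemma mirror_lit i (k : 'I_K) (l : Lit) : (i < 4)%N ->
  mirror n (lit_vertex n N i k (l.1, val l.2)) =
  lit_vertex n N i k ((neg_lit l).1, val (neg_lit l).2).
Proof.
case: l => [[] v] i4 //=; rewrite /lit_vertex /= /mirror /var_vertex.
have := ltn_ord v; have := ltn_ord k; nia.
Qed.

Lemma mean_le1 (g : Lit -> R) : (forall l, `|g l| <= 1) -> `|mean g| <= 1.
Proof.
move=> g1; have L_gt0 : (0 < #|{: Lit}|)%N by rewrite card_prod card_bool card_ord; lia.
rewrite normrM normfV normr_nat ler_pdivrMr ?ltr0n // mul1r.
apply: (le_trans (ler_norm_sum _ _ _)).
by apply: le_trans (ler_sum _ (fun l _ => g1 l)) _; rewrite sumr_const.
Qed.

Lemma sum_mean_small : `|\sum_i mean (lit_mean i)| <= c%:R^-1.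
Proof.
have NK0 : 0 < (2 * N * K)%:R :> R by rewrite ltr0n; nia.
have main_sum : (\sum_i mean (lit_mean i)) * (2 * N * K)%:R =
    \sum_(w < K * 4 * N) (s w + s (mirror n w)).
  pose F w := s w + s (mirror n w).
  rewrite (sum_ord_mul (K * 4) N F) (sum_ord_mul K 4 (fun a => \sum_(v < N) F (a * N + v)%N)).
  rewrite [RHS]exchange_big mulr_suml /=; apply: eq_bigr => i _.
  transitivity (\sum_(l : Lit) \sum_(k < K) s (lit_vertex n N i k (l.1, val l.2))).
    rewrite /mean /lit_mean card_prod card_bool card_ord -mulr_suml natrM.
    by field; rewrite !pnatr_eq0; lia.
  rewrite exchange_big /=; apply: eq_bigr => k _.
  rewrite (eq_bigr (fun l : Lit => s (lit_vertex n N i k (l.1, val l.2)))) //.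
  rewrite -(pair_bigA _ (fun b v => s (lit_vertex n N i k (b, val v)))) /=.
  by rewrite big_bool /= addrC -big_split /=; apply: eq_bigr => v _; rewrite /lit_vertex /F /var_vertex /= (mulnC 4).
have all_sum : \sum_(w < K * 4 * N + (M + lo)) (s w + s (mirror n w)) = 0.
  have half : (n = (K * 4 * N + (M + lo)) + (K * 4 * N + (M + lo)))%N by lia.
  transitivity (\sum_(w < n) s w) => //.
  set h := (K * 4 * N + (M + lo))%N in half *; clearbody h.
  rewrite big_split /= half big_split_ord /=; congr (_ + _).
  rewrite (reindex_inj rev_ord_inj) /=; apply: eq_bigr => w _; rewrite /mirror.
  by congr s; have := ltn_ord w; lia.
have rest_sum : `|\sum_(w < K * 4 * N) (s w + s (mirror n w))| <= 2 * (M + lo)%:R.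
  move: all_sum; rewrite big_split_ord /= => /eqP; rewrite addr_eq0 => /eqP ->.
  rewrite normrN; apply: (le_trans (ler_norm_sum _ _ _)).
  apply: (@le_trans _ _ (\sum_(w < M + lo) 2)).
    apply: ler_sum => w _; apply: (le_trans (ler_normD _ _)).
    by rewrite !s_norm.
  by rewrite sumr_const card_ord -[_ *+ (M + lo)]mulr_natr.
move: rest_sum; rewrite -main_sum normrM [X in _ * X]gtr0_norm //.
rewrite -ler_pdivlMr // => /le_trans; apply.
rewrite ler_pdivrMr // [leRHS]mulrC ler_pdivlMr ?ltr0n // -!natrM ler_nat.
by have := few_others; nia.
Qed.

(* The difference of the elementary symmetric polynomials e2 - e4. *)
Definition e2e4 (F : 'I_4 -> R) : R :=
  F (inord 0) * F (inord 1) + F (inord 0) * F (inord 2) + F (inord 0) * F (inord 3) +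
  F (inord 1) * F (inord 2) + F (inord 1) * F (inord 3) + F (inord 2) * F (inord 3) -
  F (inord 0) * F (inord 1) * F (inord 2) * F (inord 3).

Lemma sum_e2e4_le (y : 'I_4 -> Lit -> R) : (forall i l, `|y i l| <= 1) ->
  `|\sum_i mean (y i)| <= c%:R^-1 ->
  \sum_(j < M) e2e4 (fun i => y i (f j i)) <= M%:R * (7 / (3 * c%:R)).
Proof.
move=> y_le1 mean_le.
have L0 : (#|{: Lit}|)%:R != 0 :> R by rewrite card_prod card_bool card_ord pnatr_eq0; lia.
have pair (p q : 'I_4) : p != q ->
    \sum_(j < M) y p (f j p) * y q (f j q) <= M%:R / (6 * c)%:R + M%:R * (mean (y p) * mean (y q)).
  move=> pq.
  have pairE (F : 'I_4 -> R) : (forall i, i != p -> i != q -> F i = 1) -> \prod_i F i = F p * F q.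
    move=> F1; rewrite (bigD1 p) //= (bigD1 q) 1?eq_sym //= big1 ?mulr1 //.
    by move=> i /andP[ip iq]; exact: F1.
  pose z i l := if (i == p) || (i == q) then y i l else 1.
  have := disc_le (y := z); rewrite /discrepancy pairE; last first.
    move=> i /negPf ip /negPf iq; rewrite /mean /z ip iq /= sumr_const.
    by rewrite divff.
  rewrite (eq_bigr (fun j => y p (f j p) * y q (f j q))); last first.
    move=> j _; rewrite pairE /z ?eqxx ?orbT //.
    by move=> i /negPf -> /negPf ->.
  rewrite /z !eqxx orbT /= lerBlDr; apply.
  by move=> i l; rewrite /z; case: ifP => // _; rewrite normr1.
have quad : - \sum_(j < M) y (inord 0) (f j (inord 0)) * y (inord 1) (f j (inord 1)) *
    y (inord 2) (f j (inord 2)) * y (inord 3) (f j (inord 3)) <=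
    M%:R / (6 * c)%:R - M%:R * (mean (y (inord 0)) * mean (y (inord 1)) *
       mean (y (inord 2)) * mean (y (inord 3))).
  pose z (i : 'I_4) l := if i == inord 0 then - y i l else y i l.
  have := disc_le (y := z); rewrite /discrepancy prod4.
  have inord_neq k : (0 < k < 4)%N -> (inord k == inord 0 :> 'I_4) = false.
    by move=> k4; apply/eqP => /(congr1 val); rewrite /= !inordK; lia.
  rewrite (eq_bigr (fun j => - (y (inord 0) (f j (inord 0)) * y (inord 1) (f j (inord 1)) *
    y (inord 2) (f j (inord 2)) * y (inord 3) (f j (inord 3))))); last first.
    by move=> j _; rewrite prod4 /z eqxx !inord_neq // !mulNr.
  rewrite sumrN /z eqxx !inord_neq //.
  have -> : mean (fun l => - y (inord 0) l) = - mean (y (inord 0)).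
    by rewrite /mean sumrN mulNr.
  rewrite !mulNr !mulrN opprK -lerBrDr; apply.
  by move=> i l; case: ifP => _; rewrite ?normrN.
have inord_neq k m : (k < 4)%N -> (m < 4)%N -> k != m -> (inord k : 'I_4) != inord m.
  by move=> k4 m4; apply: contraNneq => /(congr1 val); rewrite /= !inordK // => ->.
have p01 := pair _ _ (inord_neq 0%N 1%N isT isT isT).
have p02 := pair _ _ (inord_neq 0%N 2%N isT isT isT).
have p03 := pair _ _ (inord_neq 0%N 3%N isT isT isT).
have p12 := pair _ _ (inord_neq 1%N 2%N isT isT isT).
have p13 := pair _ _ (inord_neq 1%N 3%N isT isT isT).
have p23 := pair _ _ (inord_neq 2%N 3%N isT isT isT).
rewrite /e2e4 sumrB !big_split /=.
have mean1 i : `|mean (y i)| <= 1 by apply: mean_le1 => l; exact: y_le1.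
have := mean_value_bound (mean1 (inord 0)) (mean1 (inord 1)) (mean1 (inord 2)) (mean1 (inord 3)).
move: mean_le; rewrite sum4; set mu := (X in `|X|) => mean_le mu_le.
have c0 : 0 < c%:R :> R by rewrite ltr0n.
have mu2 : mu ^+ 2 <= c%:R^-1.
  rewrite -[mu ^+ 2]real_normK ?num_real // expr2.
  apply: le_trans (mean_le); apply: ler_piMr => //; apply: (le_trans mean_le).
  by rewrite invf_le1 // ler1n.
have cE : M%:R / (6 * c)%:R = M%:R * c%:R^-1 / 6 :> R by rewrite natrM; field; rewrite gt_eqF.
have cE' : M%:R * (7 / (3 * c%:R)) = M%:R * c%:R^-1 * (7 / 3) :> R by field; rewrite gt_eqF.
have M0 : 0 <= M%:R :> R by [].
have : 0 <= M%:R * c%:R^-1 :> R by rewrite mulr_ge0 // invr_ge0.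
have := ler_wpM2l M0 mu2; have := ler_wpM2l M0 mu_le.
move: quad p01 p02 p03 p12 p13 p23; rewrite cE cE' {cE cE' mu_le mean1 mu2 M0 mean_le pair inord_neq}.
rewrite /mu {mu}; set ci := c%:R^-1.
move: (mean (y (inord 0))) (mean (y (inord 1))) (mean (y (inord 2))) (mean (y (inord 3))) => m0 m1 m2 m3.
do 7 ![set S := \sum_(j < M) _; move: S => ?].
lra.
Qed.

Definition cut_edge (e : nat * nat) : R := (1 - s e.1 * s e.2) / 2.

Lemma cut_edge_le1 e : cut_edge e <= 1.
Proof.
have : -1 <= s e.1 * s e.2 <= 1 by rewrite -ler_norml normrM !s_norm mulr1.
by rewrite /cut_edge => /andP[? ?]; lra.
Qed.

Lemma star_cut_le (a : nat) (w : 'I_4 -> 'I_K -> nat) (y : 'I_4 -> R) :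
  (forall i, y i = (\sum_k s (w i k)) / K%:R) ->
  \sum_i \sum_k cut_edge (a, w i k) <= K%:R * (11 / 4 + e2e4 y / 4).
Proof.
move=> yE; have K0 : K%:R != 0 :> R by rewrite pnatr_eq0; lia.
have K_ge0 : 0 <= K%:R :> R by [].
have y_le1 i : `|y i| <= 1.
  rewrite yE normrM normfV normr_nat ler_pdivrMr ?ltr0n // mul1r.
  apply: (le_trans (ler_norm_sum _ _ _)).
  by rewrite (eq_bigr (fun=> 1)) ?sumr_const ?card_ord // => k _; exact: s_norm.
have -> : \sum_i \sum_k cut_edge (a, w i k) = K%:R * (2 + - s a * (\sum_i y i) / 2).
  transitivity (\sum_i K%:R * (1 / 2 + (- s a / 2) * y i)).
    apply: eq_bigr => i _; rewrite /cut_edge /= -mulr_suml sumrB sumr_const card_ord -mulr_sumr.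
    by rewrite yE; field.
  by rewrite -mulr_sumr big_split /= sumr_const card_ord -[X in _ + X]mulr_sumr; field.
apply: ler_wpM2l => //.
have := @multiaffine_ineq R (- s a) (y (inord 0)) (y (inord 1)) (y (inord 2)) (y (inord 3)).
rewrite normrN => /(_ (s_norm a) (y_le1 _) (y_le1 _) (y_le1 _) (y_le1 _)).
by rewrite sum4 /e2e4; lra.
Qed.

Lemma raw_cut_le :
  \sum_(e <- raw_edges c n N K M lits) cut_edge e
    <= (11 / 16 + 1 / (4 * c)%:R) * (24 * c * K * M)%:R.
Proof.
pose y' i l := lit_mean i (neg_lit l).
have mean_y' i : mean (y' i) = mean (lit_mean i).
  rewrite /mean; congr (_ / _); rewrite [RHS](reindex_inj (h := neg_lit)) //.
  by apply: (can_inj (g := neg_lit)) => -[b v]; rewrite /neg_lit /= negbK.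
have E1 := sum_e2e4_le lit_mean_le1 sum_mean_small.
have E2 : \sum_(j < M) e2e4 (fun i => y' i (f j i)) <= M%:R * (7 / (3 * c%:R)).
  apply: sum_e2e4_le => [i l|]; first exact: lit_mean_le1.
  by rewrite (eq_bigr _ (fun i _ => mean_y' i)); exact: sum_mean_small.
have c1 : 0 <= (3 * c - 1)%:R :> R by [].
rewrite sum_raw_edges.
apply: (@le_trans _ _ (\sum_(j < M) ((3 * c - 1)%:R *
   (K%:R * (11 / 4 + e2e4 (fun i => lit_mean i (f j i)) / 4) +
    K%:R * (11 / 4 + e2e4 (fun i => y' i (f j i)) / 4)) + 8 * K%:R))).
  apply: ler_sum => j _; set a := aux_vertex N K j.
  under eq_bigr => i _ do rewrite big_split big_split /=.
  rewrite big_split big_split /=; apply: lerD; last first.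
    apply: (@le_trans _ _ (\sum_(i < 4) \sum_(k < K) 2)).
      apply: ler_sum => i _; apply: ler_sum => k _.
      by have := cut_edge_le1 (0, 4 * N)%N; rewrite mulr2n; lra.
    rewrite !sumr_const !card_ord -[_ *+ K]mulr_natr; lra.
  rewrite mulrDr; apply: lerD.
    apply: le_trans (ler_wpM2l c1 (star_cut_le a (w := fun i k => lit_vertex n N i k (lits j i))
      (y := fun i => lit_mean i (f j i)) _)).
      rewrite mulr_sumr le_eqVlt; apply/orP; left; apply/eqP; apply: eq_bigr => i _.
      by rewrite mulr_sumr; apply: eq_bigr => k _; rewrite mulr_natl.
    by move=> i; rewrite /lit_mean; under [in RHS]eq_bigr => k _ do rewrite lits_f.
  apply: le_trans (ler_wpM2l c1 (star_cut_le (mirror n a)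
    (w := fun i k => mirror n (lit_vertex n N i k (lits j i))) (y := fun i => y' i (f j i)) _)).
    rewrite mulr_sumr le_eqVlt; apply/orP; left; apply/eqP; apply: eq_bigr => i _.
    by rewrite mulr_sumr; apply: eq_bigr => k _; rewrite mulr_natl.
  move=> i; rewrite /y' /lit_mean; under [in RHS]eq_bigr => k _ do rewrite lits_f mirror_lit //.
  by [].
rewrite (eq_bigr (fun j => ((3 * c - 1)%:R * K%:R * (11 / 2) + 8 * K%:R) +
  ((3 * c - 1)%:R * K%:R / 4) * (e2e4 (fun i => lit_mean i (f j i)) +
     e2e4 (fun i => y' i (f j i))))); last by move=> j _; field.
rewrite big_split /= sumr_const card_ord -mulr_sumr big_split /= -[_ *+ M]mulr_natr.
have c0 : c%:R != 0 :> R by rewrite pnatr_eq0; lia.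
have t0 : 0 <= (3 * c - 1)%:R * K%:R / 4 :> R by rewrite !mulr_ge0 ?invr_ge0.
have := ler_wpM2l t0 (lerD E1 E2); set t := _ / 4 => t_le.
apply: (le_trans (lerD (lexx _) t_le)); rewrite /t.
have -> : (3 * c - 1)%:R = 3 * c%:R - 1 :> R by rewrite natrB ?natrM //; lia.
rewrite -subr_ge0 !natrM.
rewrite (_ : _ - _ = K%:R * M%:R * c%:R^-1 * (7 / 6)); last by field.
by rewrite !mulr_ge0 ?invr_ge0.
Qed.

End Soundness.

Section Cuts.
Variables (R : realType) (n : nat).

Definition cut_sign (S : {set 'I_n}) (w : nat) : R :=
  if insub w is Some a then (-1) ^+ (a \in S) else 1.

Lemma cut_signE (S : {set 'I_n}) (a : 'I_n) : cut_sign S a = (-1) ^+ (a \in S).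
Proof. by rewrite /cut_sign valK. Qed.

Lemma cut_sign_norm (S : {set 'I_n}) w : `|cut_sign S w| = 1.
Proof. by rewrite /cut_sign; case: insub => [a|]; rewrite ?normr_sign ?normr1. Qed.

Lemma sum_cut_sign (S : {set 'I_n}) : bisection S -> \sum_(w < n) cut_sign S w = 0.
Proof.
move=> /eqP SC; rewrite (eq_bigr (fun a : 'I_n => (-1) ^+ (a \in S))) => [|a _]; last exact: cut_signE.
rewrite (bigID (mem S)) /= (eq_bigr (fun=> -1)) => [|a ->]; last by rewrite expr1.
rewrite sumr_const [X in _ + X](eq_bigr (fun=> 1)) => [|a /negPf ->]; last by rewrite expr0.
rewrite (eq_bigl (fun a => a \in ~: S)) => [|a]; last by rewrite inE.
by rewrite sumr_const -SC mulNrn addNr.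
Qed.

Lemma cut_fraction_to_instance (s : seq (nat * nat)) (S : {set 'I_n}) :
  all (fun e => [&& e.1 < n, e.2 < n & e.1 != e.2])%N s ->
  cut_fraction R (to_instance n s) S =
  (\sum_(e <- s) cut_edge (cut_sign S) e) / (size s)%:R.
Proof.
move=> /to_instanceE sE; rewrite /cut_fraction -{3 4}sE size_map big_map; congr (_ / _).
rewrite -sum1_count natr_sum big_mkcond; apply: eq_bigr => e _.
rewrite /cut_edge /= !cut_signE.
by case: (_ \in S); case: (_ \in S) => /=; rewrite ?expr1 ?expr0; field.
Qed.

End Cuts.

(** * The sampling program *)

Section Programs.
Local Open Scope nat_scope.

Definition runs (c : cmd) (s s' : config) (T : nat) : Prop :=
  exists2 t, t <= T & exec c s t s'.

Definition hoare (P : config -> Prop) c (Q : config -> Prop) T : Prop :=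
  forall s, P s -> exists2 s', runs c s s' T & Q s'.

Lemma hoare_conseq P P' c Q Q' T T' : (forall s, P' s -> P s) ->
  (forall s, Q s -> Q' s) -> T <= T' -> hoare P c Q T -> hoare P' c Q' T'.
Proof.
move=> PP' QQ' TT' h s /PP' /h [s' [t tT ex] /QQ' Qs']; exists s' => //.
by exists t => //; apply: leq_trans TT'.
Qed.

Lemma hoare_then P Q S c1 c2 T1 T2 :
  hoare P c1 Q T1 -> hoare Q c2 S T2 -> hoare P (Then c1 c2) S (T1 + T2).
Proof.
move=> h1 h2 s /h1 [s1 [t1 t1T ex1] /h2 [s2 [t2 t2T ex2] Ss2]]; exists s2 => //.
by exists (t1 + t2); [exact: leq_add | exact: ExecThen ex1 ex2].
Qed.

Lemma hoare_skip (P : config -> Prop) : hoare P Skip P 1.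
Proof. by move=> s Ps; exists s => //; exists 1 => //; exact: ExecSkip. Qed.

Lemma hoare_if P Q e c1 c2 T :
  hoare (fun s => P s /\ eval (memory s) e != 0) c1 Q T ->
  hoare (fun s => P s /\ eval (memory s) e = 0) c2 Q T ->
  hoare P (If e c1 c2) Q T.+1.
Proof.
move=> h1 h2 s Ps; have [e0|e0] := eqVneq (eval (memory s) e) 0.
  have [s' [t tT ex] Qs'] := h2 s (conj Ps e0).
  by exists s' => //; exists t.+1 => //; exact: ExecIfFalse.
have [s' [t tT ex] Qs'] := h1 s (conj Ps e0).
by exists s' => //; exists t.+1 => //; exact: ExecIfTrue.
Qed.

Lemma hoare_while (Inv : nat -> config -> Prop) k e c T :
  (forall i, i < k -> hoare (Inv i) c (Inv i.+1) T) ->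
  (forall i s, i < k -> Inv i s -> eval (memory s) e != 0) ->
  (forall s, Inv k s -> eval (memory s) e = 0) ->
  hoare (Inv 0) (While e c) (Inv k) (k * T.+1 + 1).
Proof.
move=> body go stop.
suff loop m : m <= k -> hoare (Inv (k - m)) (While e c) (Inv k) (m * T.+1 + 1).
  by rewrite -{1}(subnn k); exact: loop.
elim: m => [|m IHm] mk s Is.
  rewrite subn0 in Is; exists s => //; exists 1 => //; apply: ExecWhileFalse.
  exact: stop.
have ik : k - m.+1 < k by lia.
have [s1 [t1 t1T ex1] Is1] := body _ ik s Is.
rewrite (_ : (k - m.+1).+1 = k - m) in Is1; last by lia.
have [s2 [t2 t2T ex2] Is2] := IHm (ltnW mk) s1 Is1.
exists s2 => //; exists (t1 + t2).+1; first by lia.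
by apply: ExecWhileTrue ex1 ex2; exact: go ik Is.
Qed.

Definition registers (vs : seq nat) : nat -> nat := nth 0 vs.

Lemma update_registers vs a v : update (registers vs) a v = registers (set_nth 0 vs a v).
Proof.
by apply/boolp.funext => x; rewrite /update /registers nth_set_nth /=.
Qed.

Lemma runs_store vs a e r o :
  runs (Store (Const a) e) (Config (registers vs) r o)
    (Config (registers (set_nth 0 vs a (eval (registers vs) e))) r o) 1.
Proof. by exists 1 => //; rewrite -update_registers; exact: ExecStore. Qed.

Lemma runs_flip vs a b r o :
  runs (Flip (Const a)) (Config (registers vs) (b :: r) o)
    (Config (registers (set_nth 0 vs a b)) r o) 1.
Proof. by exists 1 => //; rewrite -update_registers; exact: ExecFlip. Qed.

Lemma hoare_store (P Q : config -> Prop) a e :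
  (forall s, P s -> exists vs r o, s = Config (registers vs) r o /\
    Q (Config (registers (set_nth 0 vs a (eval (registers vs) e))) r o)) ->
  hoare P (Store (Const a) e) Q 1.
Proof.
move=> h s /h [vs [r [o [-> Qs]]]].
by exists (Config (registers (set_nth 0 vs a (eval (registers vs) e))) r o) => //; exact: runs_store.
Qed.

Lemma hoare_flip (P Q : config -> Prop) a :
  (forall s, P s -> exists vs (b : bool) r o, s = Config (registers vs) (b :: r) o /\
    Q (Config (registers (set_nth 0 vs a b)) r o)) ->
  hoare P (Flip (Const a)) Q 1.
Proof.
move=> h s /h [vs [b [r [o [-> Qs]]]]].
by exists (Config (registers (set_nth 0 vs a b)) r o) => //; exact: runs_flip.
Qed.

Fixpoint emit_times (m : nat) e1 e2 : cmd :=
  if m is m'.+1 then Then (Emit e1 e2) (emit_times m' e1 e2) else Skip.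

Lemma runs_emit_times m e1 e2 mm r o :
  runs (emit_times m e1 e2) (Config mm r o)
    (Config mm r (o ++ nseq m (eval mm e1, eval mm e2))) m.+1.
Proof.
elim: m o => [|m IHm] o /=; first by rewrite cats0; exists 1 => //; exact: ExecSkip.
have [t tm ex] := IHm (rcons o (eval mm e1, eval mm e2)).
exists (1 + t); first by lia.
apply: ExecThen; first exact: ExecEmit.
by rewrite -cat_rcons.
Qed.

Lemma hoare_emit_times (P Q : config -> Prop) m e1 e2 :
  (forall s, P s -> Q (Config (memory s) (coin_tape s)
     (emitted s ++ nseq m (eval (memory s) e1, eval (memory s) e2)))) ->
  hoare P (emit_times m e1 e2) Q m.+1.
Proof.
move=> h [mm r o] /h /= Qs.
by exists (Config mm r (o ++ nseq m (eval mm e1, eval mm e2))) => //; exact: runs_emit_times.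
Qed.

Definition reg i := Read (Const i).
Definition times m e := iter m (Plus e) (Const 0).

Lemma eval_times mm m e : eval mm (times m e) = m * eval mm e.
Proof. by elim: m => //= m ->; rewrite mulSn. Qed.

(* Registers: 0 holds n, 1 n/2, 2 N, 3 N B, 4 M, 5 the number of isolated
   vertices in each half, 6 K, 7 the current auxiliary vertex, 8 the number of
   constraints left, 9 and 10 the sign and the variable of the current literal;
   11-15 are scratch. *)
Definition read_literal : cmd :=
  Then (Flip (Const 9))
  (Then (Store (Const 10) (Const 0))
  (Then (Store (Const 11) (Const 1))
    (While (Minus (reg 2) (reg 11))
      (Then (Flip (Const 12))
      (Then (Store (Const 10) (Plus (Plus (reg 10) (reg 10)) (reg 12)))
            (Store (Const 11) (Plus (reg 11) (reg 11)))))))).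

Definition mirror_expr e := Minus (reg 0) (Plus e (Const 1)).

Definition emit_unit c : cmd :=
  Then (If (reg 9) (Store (Const 15) (mirror_expr (reg 13))) (Store (Const 15) (reg 13)))
  (Then (emit_times (3 * c - 1) (reg 7) (reg 15))
  (Then (emit_times (3 * c - 1) (mirror_expr (reg 7)) (mirror_expr (reg 15)))
        (emit_times 2 (Const 0) (times 4 (reg 2))))).

Definition emit_literal c i : cmd :=
  Then (Store (Const 13) (Plus (times i (reg 2)) (reg 10)))
  (Then (Store (Const 14) (reg 6))
    (While (reg 14)
      (Then (emit_unit c)
      (Then (Store (Const 13) (Plus (reg 13) (times 4 (reg 2))))
            (Store (Const 14) (Minus (reg 14) (Const 1))))))).

Definition literal_block c i : cmd := Then read_literal (emit_literal c i).

Definition clause_block c : cmd :=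
  Then (literal_block c 0) (Then (literal_block c 1)
  (Then (literal_block c 2) (Then (literal_block c 3)
  (Then (Store (Const 7) (Plus (reg 7) (Const 1)))
        (Store (Const 8) (Minus (reg 8) (Const 1))))))).

Definition set_parameters C B : cmd :=
  Then (Store (Const 2) (Const 1))
  (Then (Store (Const 3) (Const B))
  (Then (While (Minus (Plus (reg 1) (Const 1)) (Plus (reg 3) (reg 3)))
          (Then (Store (Const 2) (Plus (reg 2) (reg 2)))
                (Store (Const 3) (Plus (reg 3) (reg 3)))))
  (Then (Store (Const 4) (times C (reg 2)))
  (Then (Store (Const 5) (Minus (reg 1) (reg 4)))
  (Then (While (Minus (Plus (reg 5) (Const 1)) (times 4 (reg 2)))
          (Then (Store (Const 5) (Minus (reg 5) (times 4 (reg 2))))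
                (Store (Const 6) (Plus (reg 6) (Const 1)))))
  (Then (Store (Const 7) (Minus (Minus (reg 1) (reg 4)) (reg 5)))
        (Store (Const 8) (reg 4)))))))).

Definition halve : cmd :=
  While (Minus (reg 0) (Plus (reg 1) (reg 1))) (Store (Const 1) (Plus (reg 1) (Const 1))).

Definition sampler c C B : cmd :=
  Then halve
  (Then (If (Minus (reg 1) (Const B.-1)) (set_parameters C B) Skip)
        (While (reg 8) (clause_block c))).

Definition bits_value (s : seq bool) : nat := foldl (fun v (b : bool) => v + v + b) 0 s.

Definition tape_literal L (t : seq bool) : bool * nat :=
  (head false t, bits_value (take L (behead t))).

Lemma bits_value_rcons s b : bits_value (rcons s b) = bits_value s + bits_value s + b.
Proof. by rewrite /bits_value foldl_rcons. Qed.

Section Blocks.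
Variables (c n h N L Q M lo K A J : nat).
Hypothesis N_eq : N = 2 ^ L.

Definition state (scr : 7.-tuple nat) t o : config :=
  Config (registers ([:: n; h; N; Q; M; lo; K; A; J] ++ scr)) t o.

Definition at_clause t o (s : config) : Prop := exists scr, s = state scr t o.

Definition after_literal l t o (s : config) : Prop :=
  exists p b id kk w, s = Config (registers [:: n; h; N; Q; M; lo; K; A; J;
    nat_of_bool l.1; l.2; p; b; id; kk; w]) t o.

Lemma at_clauseP t o s : at_clause t o s -> exists a b d e f g i,
  s = Config (registers [:: n; h; N; Q; M; lo; K; A; J; a; b; d; e; f; g; i]) t o.
Proof.
case=> -[[|a [|b [|d [|e [|f [|g [|i [|? ?]]]]]]]] //= sz] ->.
by exists a, b, d, e, f, g, i.
Qed.

Lemma at_clause_intro t o a b d e f g i :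
  at_clause t o (Config (registers [:: n; h; N; Q; M; lo; K; A; J; a; b; d; e; f; g; i]) t o).
Proof. by exists [tuple a; b; d; e; f; g; i]. Qed.

Lemma hoare_read_literal t o : L < size t ->
  hoare (at_clause t o) read_literal (after_literal (tape_literal L t) (drop L.+1 t) o)
    (4 * L + 4).
Proof.
case: t => // b0 t; rewrite /= ltnS => Lt.
pose inv i (s : config) := exists b id kk w, s = Config (registers [:: n; h; N; Q; M; lo; K; A; J;
    nat_of_bool b0; bits_value (take i t); 2 ^ i; b; id; kk; w]) (drop i t) o.
rewrite (_ : 4 * L + 4 = 1 + (1 + (1 + (L * (1 + (1 + 1)).+1 + 1)))); last by lia.
pose P1 (s : config) := exists a b d e f g, s = Config (registers [:: n; h; N; Q; M; lo; K; A; J;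
    nat_of_bool b0; a; b; d; e; f; g]) t o.
pose P2 (s : config) := exists b d e f g, s = Config (registers [:: n; h; N; Q; M; lo; K; A; J;
    nat_of_bool b0; 0; b; d; e; f; g]) t o.
apply: (@hoare_then _ P1).
  apply: hoare_flip => s /at_clauseP [a [b [d [e [f [g [i ->]]]]]]].
  by do 4 eexists; split; [reflexivity | do 6 eexists; reflexivity].
apply: (@hoare_then _ P2).
  apply: hoare_store => s [a [b [d [e [f [g ->]]]]]].
  by do 3 eexists; split; [reflexivity | do 5 eexists; reflexivity].
apply: (@hoare_then _ (inv 0)).
  apply: hoare_store => s [b [d [e [f [g ->]]]]].
  by do 3 eexists; split; [reflexivity | rewrite /inv take0 drop0; do 4 eexists; reflexivity].
apply: (@hoare_conseq (inv 0) _ _ (inv L) _ (L * (1 + (1 + 1)).+1 + 1)) => //.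
  move=> s [b [id [kk [w ->]]]]; rewrite /after_literal /tape_literal /= .
  by do 5 eexists; reflexivity.
apply: hoare_while => [i iL|i s iL|s].
- pose I1 (s : config) := exists id kk w, s = Config (registers [:: n; h; N; Q; M; lo; K; A; J;
    nat_of_bool b0; bits_value (take i t); 2 ^ i; nat_of_bool (nth false t i); id; kk; w]) (drop i.+1 t) o.
  pose I2 (s : config) := exists id kk w, s = Config (registers [:: n; h; N; Q; M; lo; K; A; J;
    nat_of_bool b0; bits_value (take i.+1 t); 2 ^ i; nat_of_bool (nth false t i); id; kk; w]) (drop i.+1 t) o.
  apply: (@hoare_then _ I1).
    apply: hoare_flip => s [b [id [kk [w ->]]]].
    rewrite (drop_nth false); last by lia.
    by do 4 eexists; split; [reflexivity | do 3 eexists; reflexivity].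
  apply: (@hoare_then _ I2).
    apply: hoare_store => s [id [kk [w ->]]].
    do 3 eexists; split; first reflexivity.
    rewrite /I2 (take_nth false) ?bits_value_rcons; last by lia.
    by do 3 eexists; reflexivity.
  apply: hoare_store => s [id [kk [w ->]]].
  do 3 eexists; split; first reflexivity.
  by rewrite /inv expnS mul2n -addnn; do 4 eexists; reflexivity.
- by move=> [b [id [kk [w ->]]]]; rewrite /= N_eq subn_eq0 -ltnNge ltn_exp2l.
- by move=> [b [id [kk [w ->]]]]; rewrite /= N_eq subnn.
Qed.

Definition unit_time := 2 + ((3 * c - 1).+1 + ((3 * c - 1).+1 + 3)).

Lemma hoare_emit_unit (l : bool * nat) p b id kk t o w0 :
  let w := if l.1 then mirror n id else id in
  hoare (eq (Config (registers [:: n; h; N; Q; M; lo; K; A; J; nat_of_bool l.1; l.2; p; b; id; kk; w0]) t o))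
    (emit_unit c)
    (eq (Config (registers [:: n; h; N; Q; M; lo; K; A; J; nat_of_bool l.1; l.2; p; b; id; kk; w]) t
       (o ++ unit_edges c n N A w)))
    unit_time.
Proof.
move=> w; pose S o' := Config
  (registers [:: n; h; N; Q; M; lo; K; A; J; nat_of_bool l.1; l.2; p; b; id; kk; w]) t o'.
apply: (@hoare_then _ (eq (S o))).
  apply: hoare_if; apply: hoare_store => s [<-] /= l1; do 3 eexists; split; try reflexivity;
    by rewrite /S /w; case: (l.1) l1 => //= _; rewrite /mirror addn1.
apply: (@hoare_then _ (eq (S (o ++ nseq (3 * c - 1) (A, w))))).
  by apply: hoare_emit_times => s <-.
apply: (@hoare_then _ (eq (S (o ++ nseq (3 * c - 1) (A, w) ++
    nseq (3 * c - 1) (mirror n A, mirror n w))))).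
  by apply: hoare_emit_times => s <- /=; rewrite /S catA /mirror !addn1.
by apply: hoare_emit_times => s <-; rewrite eval_times /S /unit_edges /= -!catA.
Qed.

Definition literal_time := 1 + (1 + (K * (unit_time + (1 + 1)).+1 + 1)).

Lemma hoare_emit_literal i l t o :
  hoare (after_literal l t o) (emit_literal c i)
    (at_clause t (o ++ lit_edges c n N K A i l)) literal_time.
Proof.
pose inv0 (s : config) := exists p b kk w, s = Config (registers [:: n; h; N; Q; M; lo; K; A; J;
    nat_of_bool l.1; l.2; p; b; var_vertex N i l.2 0; kk; w]) t o.
pose inv k (s : config) := exists p b w, s = Config (registers [:: n; h; N; Q; M; lo; K; A; J;
    nat_of_bool l.1; l.2; p; b; var_vertex N i l.2 k; K - k; w]) t
    (o ++ flatten [seq unit_edges c n N A (lit_vertex n N i k l) | k <- iota 0 k]).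
apply: (@hoare_then _ inv0).
  apply: hoare_store => s [p [b [id [kk [w ->]]]]]; do 3 eexists; split; first reflexivity.
  by exists p, b, kk, w; rewrite /= eval_times.
apply: (@hoare_then _ (inv 0)).
  apply: hoare_store => s [p [b [kk [w ->]]]]; do 3 eexists; split; first reflexivity.
  by exists p, b, w; rewrite /= subn0 cats0.
apply: (@hoare_conseq (inv 0) _ _ (inv K) _ (K * (unit_time + (1 + 1)).+1 + 1)) => //.
  by move=> s [p [b [w ->]]]; exact: at_clause_intro.
apply: hoare_while => [k kK|k s kK|s].
- pose I1 (s : config) := exists p b w, s = Config (registers [:: n; h; N; Q; M; lo; K; A; J;
    nat_of_bool l.1; l.2; p; b; var_vertex N i l.2 k; K - k; w]) t
    (o ++ flatten [seq unit_edges c n N A (lit_vertex n N i k l) | k <- iota 0 k.+1]).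
  pose I2 (s : config) := exists p b w, s = Config (registers [:: n; h; N; Q; M; lo; K; A; J;
    nat_of_bool l.1; l.2; p; b; var_vertex N i l.2 k.+1; K - k; w]) t
    (o ++ flatten [seq unit_edges c n N A (lit_vertex n N i k l) | k <- iota 0 k.+1]).
  apply: (@hoare_then _ I1).
    move=> s [p [b [w0 sE]]].
    have [s' rs s'E] := @hoare_emit_unit l p b _ _ t _ w0 s (esym sE).
    exists s' => //; rewrite -s'E; exists p, b, (lit_vertex n N i k l).
    by rewrite -addn1 iotaD map_cat flatten_cat /= cats0 catA.
  apply: (@hoare_then _ I2).
    apply: hoare_store => s [p [b [w ->]]]; do 3 eexists; split; first reflexivity.
    exists p, b, w; rewrite /registers /=; congr (Config (nth 0 _)).
    by do 14 congr (_ :: _); rewrite /var_vertex; nia.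
  apply: hoare_store => s [p [b [w ->]]]; do 3 eexists; split; first reflexivity.
  by exists p, b, w; congr (Config (registers _)); rewrite /= -subnDA addn1.
- by move=> [p [b [w ->]]] /=; lia.
- by move=> [p [b [w ->]]] /=; rewrite subnn.
Qed.

Lemma hoare_literal_block i t o : L < size t ->
  hoare (at_clause t o) (literal_block c i)
    (at_clause (drop L.+1 t) (o ++ lit_edges c n N K A i (tape_literal L t)))
    (4 * L + 4 + literal_time).
Proof.
move=> Lt; apply: hoare_then; first exact: hoare_read_literal.
exact: hoare_emit_literal.
Qed.

End Blocks.

Section Main.
Variables (c C B n h L K lo : nat) (r : seq bool).
Let N := 2 ^ L.
Let M := C * N.
Let Q := N * B.
Let lits j i := tape_literal L (drop ((j * 4 + i) * L.+1) r).
Hypothesis r_size : size r = M * 4 * L.+1.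

Definition clause_time := 4 * (4 * L + 4 + literal_time c K) + 2.

Definition main_inv j (s : config) : Prop :=
  at_clause n h N Q M lo K (aux_vertex N K j) (M - j) (drop (j * 4 * L.+1) r)
    (raw_edges c n N K j lits) s.

Lemma hoare_clause_block j : j < M ->
  hoare (main_inv j) (clause_block c) (main_inv j.+1) clause_time.
Proof.
move=> jM; set A := aux_vertex N K j; pose o i :=
  raw_edges c n N K j lits ++ flatten [seq lit_edges c n N K A i (lits j i) | i <- iota 0 i].
pose inv i := at_clause n h N Q M lo K A (M - j) (drop ((j * 4 + i) * L.+1) r) (o i).
have block i : i < 4 -> hoare (inv i) (literal_block c i) (inv i.+1) (4 * L + 4 + literal_time c K).
  move=> i4; rewrite /inv.
  rewrite (_ : drop ((j * 4 + i.+1) * L.+1) r = drop L.+1 (drop ((j * 4 + i) * L.+1) r)); last first.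
    by rewrite drop_drop; congr drop; nia.
  rewrite (_ : o i.+1 = o i ++ lit_edges c n N K A i (lits j i)); last first.
    by rewrite /o -addn1 iotaD map_cat flatten_cat /= cats0 catA.
  apply: hoare_literal_block => //.
  rewrite size_drop r_size; have : (j * 4 + i).+1 * L.+1 <= M * 4 * L.+1.
    by rewrite leq_mul2r; apply/orP; right; lia.
  by rewrite mulSn; lia.
rewrite (_ : clause_time = (4 * L + 4 + literal_time c K) + ((4 * L + 4 + literal_time c K) +
  ((4 * L + 4 + literal_time c K) + ((4 * L + 4 + literal_time c K) + (1 + 1))))); last first.
  by rewrite /clause_time; lia.
apply: (@hoare_conseq (inv 0) _ _ (main_inv j.+1) _ _ _ _ _ (leqnn _)) => //.
  by move=> s; rewrite /inv /main_inv /o addn0 cats0.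
apply: hoare_then; first exact: block.
apply: hoare_then; first exact: block.
apply: hoare_then; first exact: block.
apply: hoare_then; first exact: block.
have oE : o 4 = raw_edges c n N K j.+1 lits.
  have iota_j : iota 0 j.+1 = iota 0 j ++ [:: j] by rewrite -addn1 iotaD.
  by rewrite /o /raw_edges iota_j map_cat flatten_cat /clause_edges /= !cats0.
have dropE : (j * 4 + 4) * L.+1 = j.+1 * 4 * L.+1 by congr (_ * _); lia.
apply: (@hoare_then _ (at_clause n h N Q M lo K (aux_vertex N K j.+1) (M - j)
  (drop (j.+1 * 4 * L.+1) r) (raw_edges c n N K j.+1 lits))).
  apply: hoare_store => s /at_clauseP [a [b [d [e [f [g [i ->]]]]]]].
  do 3 eexists; split; first reflexivity.
  by rewrite /= oE dropE /A /aux_vertex -addnA addn1; exact: at_clause_intro.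
apply: hoare_store => s /at_clauseP [a [b [d [e [f [g [i ->]]]]]]].
do 3 eexists; split; first reflexivity.
by rewrite /= -subnDA addn1; exact: at_clause_intro.
Qed.

Lemma hoare_main : hoare (main_inv 0) (While (reg 8) (clause_block c))
  (main_inv M) (M * clause_time.+1 + 1).
Proof.
apply: hoare_while => [j jM|j s jM|s]; first exact: hoare_clause_block.
  by move=> /at_clauseP [a [b [d [e [f [g [i ->]]]]]]] /=; lia.
by move=> /at_clauseP [a [b [d [e [f [g [i ->]]]]]]] /=; rewrite subnn.
Qed.

End Main.

Lemma initial_registers n r : initial_config n r =
  Config (registers [:: n; 0; 0; 0; 0; 0; 0; 0; 0; 0; 0; 0; 0; 0; 0; 0]) r [::].
Proof.
congr Config; apply/boolp.funext => x; rewrite /registers.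
by do 16 (case: x => [//|x]); rewrite /= nth_nil.
Qed.

Lemma hoare_halve h r :
  hoare (eq (initial_config (2 * h) r)) halve
    (eq (Config (registers [:: 2 * h; h; 0; 0; 0; 0; 0; 0; 0; 0; 0; 0; 0; 0; 0; 0]) r [::]))
    (h * 2 + 1).
Proof.
rewrite initial_registers; pose inv i := eq (Config
  (registers [:: 2 * h; i; 0; 0; 0; 0; 0; 0; 0; 0; 0; 0; 0; 0; 0; 0]) r [::]).
apply: (@hoare_while inv) => [i ih|i s ih <-|s <-] /=; try lia.
by apply: hoare_store => s <-; do 3 eexists; split; [reflexivity | rewrite /inv /= addn1].
Qed.

Lemma hoare_parameters C B h r : 0 < B -> C <= B -> B <= h ->
  let L := trunc_log 2 (h %/ B) in let N := 2 ^ L in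
  let K := (h - C * N) %/ (4 * N) in let lo := (h - C * N) %% (4 * N) in
  hoare (eq (Config (registers [:: 2 * h; h; 0; 0; 0; 0; 0; 0; 0; 0; 0; 0; 0; 0; 0; 0]) r [::]))
    (set_parameters C B)
    (at_clause (2 * h) h N (N * B) (C * N) lo K (aux_vertex N K 0) (C * N) r [::])
    (L * 3 + K * 3 + 8).
Proof.
move=> B_gt0 CB Bh L N K lo.
have hB : 0 < h %/ B by rewrite divn_gt0.
have [NB_le NB_gt] : N * B <= h /\ h < 2 * N * B.
  have /andP[] := trunc_log_bounds (isT : 1 < 2) hB; rewrite -/L expnS -/N => NhB hBN.
  by split; [rewrite -leq_divRL | rewrite -ltn_divLR].
pose st v2 v3 v4 v5 v6 v7 v8 := Config (registers
  [:: 2 * h; h; v2; v3; v4; v5; v6; v7; v8; 0; 0; 0; 0; 0; 0; 0]) r [::].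
rewrite (_ : L * 3 + K * 3 + 8 = 1 + (1 + (L * (1 + 1).+1 + 1 + (1 + (1 +
  (K * (1 + 1).+1 + 1 + (1 + 1))))))); last by lia.
pose inv1 i := eq (st (2 ^ i) (2 ^ i * B) 0 0 0 0 0).
apply: (@hoare_then _ (eq (st 1 0 0 0 0 0 0))).
  by apply: hoare_store => s <-; do 3 eexists; split; reflexivity.
apply: (@hoare_then _ (inv1 0)).
  by apply: hoare_store => s <-; do 3 eexists; split; [reflexivity | rewrite /inv1 mul1n].
apply: (@hoare_then _ (inv1 L)).
  apply: hoare_while => [i iL|i s iL <-|s <-].
  - apply: (@hoare_then _ (eq (st (2 ^ i.+1) (2 ^ i * B) 0 0 0 0 0))).
      apply: hoare_store => s <-; do 3 eexists; split; first reflexivity.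
      by rewrite /= expnS mul2n -addnn.
    apply: hoare_store => s <-; do 3 eexists; split; first reflexivity.
    by rewrite /inv1 /= expnS mul2n -addnn mulnDl.
  - rewrite /=; have : 2 ^ i.+1 * B <= N * B by rewrite leq_mul2r leq_exp2l // iL orbT.
    by rewrite expnS; lia.
  - by rewrite /= -/N; lia.
apply: (@hoare_then _ (eq (st N (N * B) (C * N) 0 0 0 0))).
  apply: hoare_store => s <-; do 3 eexists; split; first reflexivity.
  by rewrite /= eval_times.
pose inv2 i := eq (st N (N * B) (C * N) (h - C * N - i * (4 * N)) i 0 0).
apply: (@hoare_then _ (inv2 0)).
  apply: hoare_store => s <-; do 3 eexists; split; first reflexivity.
  by rewrite /inv2 /= subn0.
have N_gt0 : 0 < 4 * N by rewrite muln_gt0 expn_gt0.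
have divE : h - C * N = K * (4 * N) + lo by exact: divn_eq.
have lo_lt : lo < 4 * N by rewrite ltn_mod.
apply: (@hoare_then _ (inv2 K)).
  apply: hoare_while => [i iK|i s iK <-|s <-].
  - apply: (@hoare_then _ (eq (st N (N * B) (C * N) (h - C * N - i.+1 * (4 * N)) i 0 0))).
      apply: hoare_store => s <-; do 3 eexists; split; first reflexivity.
      rewrite (_ : h - C * N - i.+1 * (4 * N) = h - C * N - i * (4 * N) - eval
        (registers [:: 2 * h; h; N]) (times 4 (reg 2))) //.
      by rewrite eval_times mulSn /=; lia.
    by apply: hoare_store => s <-; do 3 eexists; split; [reflexivity | rewrite /inv2 /= addn1].
  - have : i.+1 * (4 * N) <= K * (4 * N) by rewrite leq_mul2r iK orbT.
    by rewrite mulSn /=; lia.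
  - by rewrite /= divE; lia.
have loE : h - C * N - K * (4 * N) = lo by rewrite divE; lia.
have CN_le : C * N <= h by apply: leq_trans NB_le; rewrite mulnC leq_mul2l CB orbT.
apply: (@hoare_then _ (eq (st N (N * B) (C * N) lo K (aux_vertex N K 0) 0))).
  apply: hoare_store => s <-; do 3 eexists; split; first reflexivity.
  rewrite /= loE /aux_vertex addn0 (_ : h - C * N - lo = 4 * K * N) //.
  by rewrite divE; lia.
apply: hoare_store => s <-; do 3 eexists; split; first reflexivity.
exact: at_clause_intro.
Qed.

End Programs.

(** * The instance distribution *)

Section Literals.
Local Open Scope nat_scope.

Lemma bits_value_lt s : bits_value s < 2 ^ size s.
Proof.
elim/last_ind: s => // s b IHs; rewrite bits_value_rcons size_rcons expnS.
by case: b => /=; lia.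
Qed.

Lemma bits_value_inj s s' : size s = size s' -> bits_value s = bits_value s' -> s = s'.
Proof.
elim/last_ind: s s' => [|s b IHs] s'; first by move/esym/size0nil->.
case/lastP: s' => [|s' b']; first by rewrite size_rcons.
rewrite !size_rcons !bits_value_rcons => -[/IHs eq_s] eqv.
have [eqv' ->] : bits_value s = bits_value s' /\ b = b' by case: b b' eqv => -[] /=; lia.
by rewrite eq_s.
Qed.

Variables (M L : nat).
Implicit Types r : (M * 4 * L.+1).-tuple bool.

Definition tape_lits (r : seq bool) (j i : nat) : bool * nat :=
  tape_literal L (drop ((j * 4 + i) * L.+1) r).

Lemma tape_lits_lt (r : seq bool) j i : (tape_lits r j i).2 < 2 ^ L.
Proof.
apply: leq_trans (bits_value_lt _) _; rewrite leq_exp2l // size_take_min.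
exact: geq_minl.
Qed.

Definition lits_of r : {ffun 'I_M -> {ffun 'I_4 -> bool * 'I_(2 ^ L)}} :=
  [ffun j : 'I_M => [ffun i : 'I_4 => ((tape_lits r j i).1, Ordinal (tape_lits_lt r j i))]].

Lemma lits_ofE r (j : 'I_M) (i : 'I_4) :
  tape_lits r j i = ((lits_of r j i).1, val (lits_of r j i).2).
Proof. by rewrite !ffunE; exact: surjective_pairing. Qed.

Lemma lits_of_inj : injective lits_of.
Proof.
move=> r r' eq_lits; apply/val_inj/(@eq_from_nth _ false); first by rewrite !size_tuple.
move=> p; rewrite size_tuple => p_lt.
pose q := p %/ L.+1; pose b := p %% L.+1.
have q_lt : q < M * 4 by rewrite ltn_divLR.
have jM : q %/ 4 < M by rewrite ltn_divLR.
have bL : b < L.+1 by rewrite ltn_mod.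
have eqj := congr1 (fun f : {ffun 'I_M -> {ffun 'I_4 -> bool * 'I_(2 ^ L)}} =>
  f (Ordinal jM) (Ordinal (ltn_pmod q (isT : 0 < 4)))) eq_lits.
have : tape_lits r (q %/ 4) (q %% 4) = tape_lits r' (q %/ 4) (q %% 4).
  have := lits_ofE r (Ordinal jM) (Ordinal (ltn_pmod q (isT : 0 < 4))).
  have := lits_ofE r' (Ordinal jM) (Ordinal (ltn_pmod q (isT : 0 < 4))).
  by rewrite /= => -> ->; rewrite eqj.
rewrite /tape_lits -divn_eq /tape_literal => -[eq_head eq_val].
have nthE (t : (M * 4 * L.+1).-tuple bool) : nth false t p = nth false (drop (q * L.+1) t) b.
  by rewrite nth_drop -divn_eq.
rewrite !nthE {nthE}; clearbody b.
have slice (t : (M * 4 * L.+1).-tuple bool) : L.+1 <= size (drop (q * L.+1) t).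
  rewrite size_drop size_tuple; have : q.+1 * L.+1 <= M * 4 * L.+1 by rewrite leq_mul2r q_lt orbT.
  by rewrite mulSn; lia.
move: (slice r) (slice r') eq_head eq_val.
case: (drop _ r) => // x t; case: (drop _ r') => // x' t' /=; rewrite !ltnS => Lt Lt' -> eqv.
have eqt := bits_value_inj _ eqv; rewrite !size_takel // in eqt.
case: b bL => //= b; rewrite ltnS => bL.
by rewrite -(nth_take false bL) eqt // nth_take.
Qed.

Lemma card_lits_of (P : pred {ffun 'I_M -> {ffun 'I_4 -> bool * 'I_(2 ^ L)}}) :
  #|[pred r | P (lits_of r)]| = #|P|.
Proof.
have card_eq : #|{ffun 'I_M -> {ffun 'I_4 -> bool * 'I_(2 ^ L)}}| = #|{: (M * 4 * L.+1).-tuple bool}|.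
  rewrite !card_ffun card_tuple card_prod card_bool !card_ord -expnS -!expnM.
  by congr (_ ^ _); lia.
have [g fK gK] := inj_card_bij lits_of_inj (eq_leq card_eq).
rewrite -(card_image (can_inj gK) P); apply: eq_card => r; rewrite inE.
apply/idP/imageP => [Pr|[f Pf ->]]; last by rewrite gK.
by exists (lits_of r); rewrite ?fK.
Qed.

End Literals.

Section Bounds.
Local Open Scope nat_scope.

Lemma even_half n : ~~ odd n -> n = 2 * n./2.
Proof. by move=> /negPf n_even; have := odd_double_half n; rewrite n_even; lia. Qed.

Lemma poly_bound (a b d n t : nat) : ~~ odd n -> t <= a * n ^ 2 + b * n + d ->
  t <= n ^ (a + b + d + 2) + (a + b + d + 2).
Proof.
move=> n_even tle; apply: leq_trans tle _.
case: n n_even => [|[|n]] // _; first by rewrite !muln0; lia.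
have : (a + b) * n.+2 ^ 2 <= n.+2 ^ (a + b + d) * n.+2 ^ 2.
  rewrite leq_mul2r; apply/orP; right; apply: leq_trans (ltnW (ltn_expl _ (isT : 1 < 2))) _.
  have pow_le k : 2 ^ k <= n.+2 ^ k by case: k => // k; rewrite leq_exp2r.
  by apply: leq_trans (pow_le _); rewrite leq_exp2l // leq_addr.
rewrite -expnD mulnDl; have : b * n.+2 <= b * n.+2 ^ 2 by rewrite leq_mul2l -{1}[n.+2]expn1 leq_exp2l ?orbT.
by lia.
Qed.

End Bounds.

Section Distribution.
Local Open Scope nat_scope.
Variable c : nat.
Hypothesis c_gt0 : 0 < c.

(* With deviation delta = 1/(6c), the Chernoff exponent delta^2 M / 8 equals 9 N,
   which beats a union bound over 2^(8N) sign vectors. *)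
Definition density := 72 * (6 * c) ^ 2.
(* So many copies that the auxiliary and isolated vertices can only unbalance
   the copies by a fraction 1/c. *)
Definition min_copies := c * (density + 4).
Definition block_size := 4 * min_copies + density.

Definition log_vars n := trunc_log 2 (n./2 %/ block_size).
Definition vars n := 2 ^ log_vars n.
Definition clauses_nb n := if block_size <= n./2 then density * vars n else 0.
Definition copies n := (n./2 - density * vars n) %/ (4 * vars n).
Definition leftover n := (n./2 - density * vars n) %% (4 * vars n).

Definition gadget_edges n (r : seq bool) : seq (nat * nat) :=
  raw_edges c n (vars n) (copies n) (clauses_nb n) (tape_lits (log_vars n) r).

Definition gadget_distribution : instance_distribution :=
  InstanceDistribution (coins := fun n => clauses_nb n * 4 * (log_vars n).+1)
    (fun n r => to_instance n (gadget_edges n r)).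

Lemma density_gt0 : 0 < density. Proof. by rewrite /density muln_gt0 expn_gt0 muln_gt0 c_gt0. Qed.

Lemma min_copies_gt1 : 1 < min_copies.
Proof. by rewrite /min_copies; have := density_gt0; nia. Qed.

Lemma block_size_gt0 : 0 < block_size.
Proof. by rewrite /block_size; have := density_gt0; lia. Qed.

Lemma vars_gt0 n : 0 < vars n. Proof. by rewrite /vars expn_gt0. Qed.

Lemma vars_bounds n : block_size <= n./2 ->
  vars n * block_size <= n./2 < 2 * vars n * block_size.
Proof.
move=> Bh; have hB : 0 < n./2 %/ block_size by rewrite divn_gt0 ?block_size_gt0.
have /andP[] := trunc_log_bounds (isT : 1 < 2) hB; rewrite -/(log_vars n) expnS -/(vars n).
by rewrite leq_divRL ?ltn_divLR ?block_size_gt0 // => -> ->.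
Qed.

Lemma half_eq n : block_size <= n./2 ->
  n./2 = 4 * copies n * vars n + density * vars n + leftover n.
Proof.
move=> /vars_bounds /andP[le _]; have := divn_eq (n./2 - density * vars n) (4 * vars n).
rewrite -/(copies n) -/(leftover n).
have : density * vars n <= n./2 by apply: leq_trans le; rewrite /block_size; nia.
by lia.
Qed.

Lemma leftover_lt n : leftover n < 4 * vars n.
Proof. by rewrite ltn_mod muln_gt0 vars_gt0. Qed.

Lemma copies_ge n : block_size <= n./2 -> min_copies <= copies n.
Proof.
move=> /vars_bounds /andP[le _]; rewrite /copies leq_divRL ?muln_gt0 ?vars_gt0 //.
by move: le; rewrite /block_size; nia.
Qed.

Lemma gadget_edges_valid n (r : (coins gadget_distribution n).-tuple bool) : ~~ odd n ->
  all (fun e => [&& e.1 < n, e.2 < n & e.1 != e.2]) (gadget_edges n r).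
Proof.
move=> n_even; case: (leqP block_size n./2) => [Bh|hB]; last first.
  by rewrite /gadget_edges /clauses_nb leqNgt hB.
apply: (raw_edges_valid c (lits_ofE r)).
- exact: vars_gt0.
- exact: leq_trans min_copies_gt1 (copies_ge Bh).
- have := even_half n_even; have := half_eq Bh; rewrite /clauses_nb Bh.
  by move: (4 * copies n * vars n) (density * vars n) => *; lia.
Qed.

Lemma gadget_edges_emitted n (r : (coins gadget_distribution n).-tuple bool) : ~~ odd n ->
  [seq (val e.1, val e.2) | e <- edges (draw r)] = gadget_edges n r.
Proof. by move=> n_even; apply: to_instanceE; exact: gadget_edges_valid. Qed.

Lemma gadget_samplable : efficiently_samplable gadget_distribution.
Proof.
pose e := 12 * c + 20.
exists (sampler c density block_size), (100 * e + 100 * e + 100 + 2) => n n_even r.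
set h := n./2; have nE : n = 2 * h := even_half n_even.
set T := 100 * e * n ^ 2 + 100 * e * n + 100.
suff [s' [t tT ex] s'E] : exists2 s', runs (sampler c density block_size)
    (initial_config n r) s' T & emitted s' = gadget_edges n r.
  exists t, s'; split => //; first exact: poly_bound n_even tT.
  by rewrite gadget_edges_emitted.
case: (leqP block_size h) => [Bh|hB].
  have r_size : size r = density * 2 ^ log_vars n * 4 * (log_vars n).+1.
    by rewrite size_tuple /= /clauses_nb Bh.
  have CB : density <= block_size by rewrite /block_size leq_addl.
  have params : hoare (eq (Config (registers [:: n; h; 0; 0; 0; 0; 0; 0; 0; 0; 0; 0; 0; 0; 0; 0]) r [::]))
      (If (Minus (reg 1) (Const block_size.-1)) (set_parameters density block_size) Skip)
      (main_inv c density block_size n h (log_vars n) (copies n) (leftover n) r 0)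
      (log_vars n * 3 + copies n * 3 + 8).+1.
    apply: hoare_if => [|s [<-] /=]; last by have := block_size_gt0; lia.
    have := @hoare_parameters _ _ _ r block_size_gt0 CB Bh; rewrite -nE => hoare_params.
    apply: hoare_conseq hoare_params => // [s []//|s].
    by rewrite /main_inv mul0n drop0 subn0.
  have halve_n := @hoare_halve h r; rewrite -nE in halve_n.
  have [s' [t tT ex] s'E] := hoare_then halve_n (hoare_then params
    (@hoare_main c density block_size n h (log_vars n) (copies n) (leftover n) r r_size)) (erefl _).
  exists s'; last first.
    have clE : clauses_nb n = density * vars n by rewrite /clauses_nb Bh.
    by have [scr ->] := s'E; rewrite /= /gadget_edges; set rr := tval r; rewrite clE.
  exists t => //; apply: leq_trans tT _.
  have hE : h = 4 * copies n * vars n + density * vars n + leftover n := half_eq Bh.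
  have L_le : log_vars n < vars n by exact: ltn_expl.
  rewrite /T /clause_time /literal_time /unit_time -/(vars n).
  have := density_gt0; have := leq_trans min_copies_gt1 (copies_ge Bh).
  move: (copies n) (vars n) (leftover n) (log_vars n) density hE L_le => K N lo L C hE L_le K_ge C_ge.
  have NK : N * K <= h by nia.
  have CN : C * N <= h by nia.
  have Lh : L <= h by nia.
  have Kh : K <= h by nia.
  set x := (_ + (1 + 1)).+1.
  have xe : x <= e by rewrite /x /e; lia.
  have CNL : C * N * L <= h * h by exact: leq_mul.
  have CNK : C * N * (K * x) <= h * h * e by rewrite mulnA; apply: leq_mul => //; exact: leq_mul.
  rewrite (_ : (4 * (4 * L + 4 + (1 + (1 + (K * x + 1)))) + 2).+1 = 16 * L + 4 * (K * x) + 31); last by lia.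
  rewrite (_ : C * N * (16 * L + 4 * (K * x) + 31) = 16 * (C * N * L) + 4 * (C * N * (K * x)) + 31 * (C * N)); last by ring.
  have e_ge : 20 <= e by rewrite /e; lia.
  have hn : h <= n by lia.
  have hh : h * h <= n ^ 2 by rewrite -mulnn leq_mul.
  have hhe : h * h * e <= e * n ^ 2 by rewrite mulnC leq_mul2l hh orbT.
  have n2e : 20 * n ^ 2 <= e * n ^ 2 by rewrite leq_mul2r e_ge orbT.
  have ne : 20 * n <= e * n by rewrite leq_mul2r e_ge orbT.
  rewrite -[100 * e * n ^ 2]mulnA -[100 * e * n]mulnA; clearbody e x h; clear nE.
  move: (C * N * L) (C * N * (K * x)) (C * N) (e * n ^ 2) (n ^ 2) (e * n) (h * h * e) (h * h)
    CNL CNK CN hh hhe n2e ne => *; lia.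
have halve_n := @hoare_halve h r; rewrite -nE in halve_n.
set S := Config (registers [:: n; h; 0; 0; 0; 0; 0; 0; 0; 0; 0; 0; 0; 0; 0; 0]) r [::].
have skip : hoare (eq S) (If (Minus (reg 1) (Const block_size.-1)) (set_parameters density block_size) Skip)
    (eq S) 2.
  apply: hoare_if => [s [<-] /=|]; first by lia.
  by apply: hoare_conseq (@hoare_skip (eq S)) => // s [].
have stop : hoare (eq S) (While (reg 8) (clause_block c)) (eq S) (0 * 1 + 1).
  by apply: (@hoare_while (fun=> eq S)) => // s <-.
have [s' [t tT ex] s'E] := hoare_then halve_n (hoare_then skip stop) (erefl _).
have cl0 : clauses_nb n = 0 by rewrite /clauses_nb leqNgt hB.
exists s'; last by rewrite -s'E /gadget_edges; set rr := tval r; rewrite cl0.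
by exists t => //; apply: leq_trans tT _; rewrite /T nE; nia.
Qed.

End Distribution.

Lemma exp_union_le (R : realType) (N : nat) : (0 < N)%N ->
  (2 ^ (8 * N))%:R * expR (- (9 * N)%:R) <= 1 / N%:R :> R.
Proof.
move=> N_gt0; have N0 : 0 < N%:R :> R by rewrite ltr0n.
have e_ge2 : 2 <= expR (1 : R) by have := expR_ge1Dx (1 : R); lra.
rewrite expRN ler_pdivrMr ?expR_gt0 // mul1r [leRHS]mulrC ler_pdivlMr //.
rewrite (_ : (9 * N)%:R = (8 * N)%:R * 1 + N%:R :> R); last by rewrite mulr1 -natrD; congr _%:R; lia.
rewrite expRD expRM_natl natrX; apply: ler_pM => //.
  by apply: lerXn2r; rewrite ?nnegrE ?expR_ge0.
by have := expR_ge1Dx (N%:R : R); lra.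
Qed.

Section HighProbability.
Variables (R : realType) (c : nat).
Hypothesis c_gt0 : (0 < c)%N.

Definition square_bound := ((64 * density c) ^ 2)%N.
Definition expansion_constant := (16 * square_bound)%N.
Definition expansion_scale n := (vars c n %/ expansion_constant)%N.
Definition sos_degree n := (expansion_scale n %/ 3)%N.

Lemma expansion_constant_gt0 : (0 < expansion_constant)%N.
Proof. by rewrite /expansion_constant /square_bound; have := density_gt0 c_gt0; nia. Qed.

Definition good n (f : {ffun 'I_(clauses_nb c n) -> {ffun 'I_4 -> bool * 'I_(2 ^ log_vars c n)}}) : bool :=
  ~~ [exists T : {set 'I_(clauses_nb c n)}, (0 < #|T| <= expansion_scale n)%N &&
       (#|span (scope f) T| < #|T|)%N] &&
  ~~ [exists x, (6 * c)%:R^-1 * (clauses_nb c n)%:R < discrepancy f (signs R x)].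

Lemma good_prob n : ~~ odd n -> (block_size c <= n./2)%N ->
  1 - (expansion_constant.+1)%:R / (vars c n)%:R <=
  #|good (n := n)|%:R / 2 ^+ coins (gadget_distribution c) n :> R.
Proof.
move=> n_even Bh; set M := clauses_nb c n; set N := vars c n.
have MN : M = (density c * N)%N by rewrite /M /clauses_nb Bh.
have N_gt0 : (0 < N)%N := vars_gt0 c n.
have N0 : 0 < N%:R :> R by rewrite ltr0n.
pose Omega := {ffun 'I_M -> {ffun 'I_4 -> bool * 'I_(2 ^ log_vars c n)}}.
have card_Omega : (#|Omega| = 2 ^ coins (gadget_distribution c) n)%N.
  rewrite /Omega !card_ffun card_prod card_bool !card_ord -expnS -!expnM /= -/M.
  by congr (_ ^ _)%N; lia.
pose bad1 := [set f : Omega | [exists T : {set 'I_M}, (0 < #|T| <= expansion_scale n)%N &&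
       (#|span (scope f) T| < #|T|)%N]].
pose bad2 := [set f : Omega | [exists x, (6 * c)%:R^-1 * M%:R < discrepancy f (signs R x)]].
have bad1_le : #|bad1|%:R <= #|Omega|%:R * (expansion_constant%:R / N%:R) :> R.
  have scale_le : (expansion_constant * expansion_scale n <= N)%N.
    by rewrite mulnC leq_divM.
  exact: (nonexpanding_prob R (erefl square_bound) N_gt0 (density_gt0 c_gt0) MN scale_le).
have c0 : (6 * c)%:R != 0 :> R by rewrite pnatr_eq0; lia.
have bad2_le : #|bad2|%:R <= #|Omega|%:R * (1 / N%:R) :> R.
  have L_gt0 : (0 < #|{: bool * 'I_(2 ^ log_vars c n)}|)%N.
    by rewrite card_prod card_bool card_ord; lia.
  pose delta : R := (6 * c)%:R^-1.
  have delta_bnd : 0 <= delta <= 1.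
    by rewrite /delta invr_ge0 ler0n invf_le1 ?ler1n ?ltr0n; lia.
  apply: le_trans (@discrepancy_prob R _ _ M L_gt0 _ delta_bnd) _.
  rewrite ler_wpM2l // card_prod card_bool !card_ord.
  have -> : ((6 * c)%:R^-1) ^+ 2 * M%:R / 8 = (9 * N)%:R :> R.
    have := c0; rewrite MN /density; move: (6 * c)%N => m m0.
    by rewrite !natrM natrX; field.
  rewrite (_ : (4 * (2 * 2 ^ log_vars c n) = 8 * N)%N); last by rewrite /N /vars; lia.
  exact: exp_union_le.
have good_compl : (#|Omega| <= #|good (n := n)| + (#|bad1| + #|bad2|))%N.
  pose G := [set f : Omega | good f].
  have -> : #|good (n := n)| = #|G| by apply: eq_card => f; rewrite [in RHS]inE.
  apply: (@leq_trans #|G :|: (bad1 :|: bad2)|).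
    apply: subset_leq_card; apply/subsetP => f _; rewrite !inE /good -negb_or.
    exact: orNb.
  by apply: leq_trans (leq_card_setU _ _) _; rewrite leq_add2l leq_card_setU.
have Omega0 : 0 < #|Omega|%:R :> R by rewrite card_Omega ltr0n expn_gt0.
rewrite -natrX -card_Omega ler_pdivlMr //.
move: good_compl; rewrite -(ler_nat R) !natrD => good_compl.
rewrite mulrBl mul1r lerBlDr; apply: (le_trans good_compl); rewrite lerD2l.
apply: (le_trans (lerD bad1_le bad2_le)); rewrite -mulrDr mulrC.
by rewrite -mulrDl -natr1.
Qed.

Definition gadget_property n (G : instance n) : Prop :=
  (exists E : {mpoly R[n]} -> R,
     sos_solution (sos_degree n) G (3 / 4 - 1 / (4 * c)%:R) E) /\
  (forall S : {set 'I_n}, bisection S ->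
     cut_fraction R G S <= 11 / 16 + 1 / (4 * c)%:R).

Lemma good_instance n (r : (coins (gadget_distribution c) n).-tuple bool) :
  ~~ odd n -> (block_size c <= n./2)%N -> (4 <= sos_degree n)%N ->
  good (lits_of r) -> gadget_property (draw r).
Proof.
move=> n_even Bh d_ge4 /andP[/existsPn expand /existsPn disc].
have N_gt0 : (0 < vars c n)%N := vars_gt0 c n.
have M_gt0 : (0 < clauses_nb c n)%N by rewrite /clauses_nb Bh muln_gt0 N_gt0 density_gt0.
have K_ge := copies_ge c_gt0 Bh.
have K_ge2 : (1 < copies c n)%N := leq_trans (min_copies_gt1 c_gt0) K_ge.
have n_eq : n = (2 * (4 * copies c n * vars c n + clauses_nb c n + leftover c n))%N.
  by rewrite {1}(even_half n_even) {1}(half_eq c_gt0 Bh) /clauses_nb Bh.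
have valid := gadget_edges_valid c_gt0 r n_even.
split.
  eexists; apply: (gadget_sos_solution R (lits_ofE r) c_gt0 N_gt0 M_gt0 K_ge2) => //.
    by rewrite [leqRHS]n_eq leq_mul2l leq_addr.
  move=> T /andP[T_gt0 Td]; have := expand T; rewrite T_gt0 /= negb_and -!leqNgt.
  have -> : (#|T| <= expansion_scale n)%N by apply: leq_trans Td _; rewrite mulnC leq_divM.
  by [].
move=> S bisS; rewrite (cut_fraction_to_instance R S valid).
have few : (c * (clauses_nb c n + leftover c n) <= copies c n * vars c n)%N.
  have := leftover_lt c n; move: K_ge; rewrite /clauses_nb Bh /min_copies.
  by move: (copies c n) (density c) (vars c n) (leftover c n) => *; nia.
have disc_le y : (forall i l, `|y i l| <= 1) ->
    discrepancy (R := R) (lits_of r) y <= (clauses_nb c n)%:R / (6 * c)%:R.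
  apply: discrepancy_signs => [|x]; last by rewrite leNgt mulrC; exact: disc.
  by rewrite card_prod card_bool card_ord; have := N_gt0; rewrite /vars; lia.
have cut_le := raw_cut_le (lits_ofE r) c_gt0 N_gt0 M_gt0 (ltnW K_ge2) n_eq few disc_le
  (cut_sign_norm R S) (sum_cut_sign R bisS).
rewrite ler_pdivrMr ?(size_raw_edges _ _ _ _ _ c_gt0) //.
by rewrite ltr0n !muln_gt0 c_gt0 M_gt0 (ltnW K_ge2).
Qed.

End HighProbability.

(** * Asymptotics *)

Section Limits.
Variables (R : realType) (c : nat).
Hypothesis c_gt0 : (0 < c)%N.

Lemma half_large n : (2 * block_size c <= n)%N -> (block_size c <= n./2)%N.
Proof. by have := odd_double_half n; case: odd => /=; lia. Qed.

Lemma vars_lower n : (2 * block_size c <= n)%N -> (n < 4 * block_size c * vars c n)%N.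
Proof.
move=> /half_large /(vars_bounds c_gt0) /andP[_].
by have := odd_double_half n; case: odd => /=; lia.
Qed.

Definition degree_ratio := (24 * block_size c * expansion_constant c)%N.

Lemma degree_ratio_gt0 : (0 < degree_ratio)%N.
Proof.
have X_gt0 := expansion_constant_gt0 c_gt0; have B_gt0 := block_size_gt0 c_gt0.
by rewrite /degree_ratio; move: (block_size c) (expansion_constant c) B_gt0 X_gt0 => *; nia.
Qed.

Lemma degree_lower n : (4 * degree_ratio <= n)%N ->
  (4 <= sos_degree c n)%N && (n <= degree_ratio * sos_degree c n)%N.
Proof.
rewrite /degree_ratio; have X_gt0 := expansion_constant_gt0 c_gt0.
have B_gt0 := block_size_gt0 c_gt0 => n_ge.
have n_ge2 : (2 * block_size c <= n)%N by apply: leq_trans n_ge; nia.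
have := vars_lower n_ge2.
have := ltn_ceil (vars c n) X_gt0; have := ltn_ceil (expansion_scale c n) (isT : 0 < 3)%N.
rewrite -/(sos_degree c n) -/(expansion_scale c n).
move: (sos_degree c n) (expansion_scale c n) (vars c n) (block_size c) (expansion_constant c)
  X_gt0 B_gt0 n_ge {n_ge2} => d s N B X X_gt0 B_gt0 n_ge sd Ns nN.
have nd : (n < 12 * B * X * d.+1)%N.
  apply: leq_trans nN _; rewrite (_ : 12 * B * X * d.+1 = 4 * B * (d.+1 * 3 * X))%N; last by ring.
  rewrite leq_mul2l; apply/orP; right; apply: leq_trans (ltnW Ns) _.
  by rewrite leq_mul2r sd orbT.
have d_ge4 : (4 <= d)%N.
  rewrite leqNgt; apply/negP => d4; have : (12 * B * X * d.+1 <= 12 * B * X * 4)%N.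
    by rewrite leq_mul2l d4 orbT.
  by lia.
rewrite d_ge4 /=; apply: leq_trans (ltnW nd) _.
rewrite (_ : 24 * B * X * d = 12 * B * X * (2 * d))%N; last by ring.
by rewrite leq_mul2l; apply/orP; right; lia.
Qed.

Lemma degree_big_Omega : big_Omega_n R (sos_degree c).
Proof.
have r0 : 0 < degree_ratio%:R :> R by rewrite ltr0n degree_ratio_gt0.
exists degree_ratio%:R^-1; first by rewrite invr_gt0.
exists (4 * degree_ratio)%N => // n /= /degree_lower /andP[_ n_le].
by rewrite mulrC ler_pdivrMr // mulrC -natrM ler_nat.
Qed.

Lemma property_prob n : ~~ odd n -> (4 * degree_ratio <= n)%N ->
  1 - (4 * block_size c * (expansion_constant c).+1)%:R / n%:R <=
  prob R (gadget_distribution c) (@gadget_property R c n).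
Proof.
move=> n_even n_ge; have /andP[d_ge4 _] := degree_lower n_ge.
have X_gt0 := expansion_constant_gt0 c_gt0; have B_gt0 := block_size_gt0 c_gt0.
have n_ge2 : (2 * block_size c <= n)%N.
  by apply: leq_trans n_ge; rewrite /degree_ratio; nia.
have N_gt0 := vars_gt0 c n; have nN := vars_lower n_ge2.
have n_gt0 : (0 < n)%N by lia.
apply: le_trans (le_trans _ (good_prob R c_gt0 n_even (half_large n_ge2))) _.
  rewrite lerD2l lerN2 ler_pdivrMr ?ltr0n // mulrAC ler_pdivlMr ?ltr0n //.
  by rewrite -!natrM ler_nat mulnC mulnAC leq_mul2r ltnW ?orbT.
rewrite /prob ler_wpM2r ?invr_ge0 ?exprn_ge0 // ler_nat -card_lits_of.
apply: subset_leq_card; apply/subsetP => r; rewrite !inE => good_r.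
by apply/asboolP; exact: (good_instance c_gt0 n_even (half_large n_ge2) d_ge4 good_r).
Qed.

Lemma prob_le1 (D : instance_distribution) n (P : instance n -> Prop) : prob R D P <= 1.
Proof.
rewrite /prob ler_pdivrMr ?exprn_gt0 // mul1r -natrX ler_nat.
by apply: leq_trans (max_card _) _; rewrite card_tuple card_bool.
Qed.

Lemma property_whp : with_high_probability R (gadget_distribution c) (@gadget_property R c).
Proof.
set a := (4 * block_size c * (expansion_constant c).+1)%N.
apply/cvgrPdist_lt => e e_gt0; rewrite near_withinE.
have [m m_gt] : exists m : nat, a%:R / e < m%:R.
  by exists (Num.bound (a%:R / e)); apply: archi_boundP; rewrite divr_ge0 // ltW.
exists (maxn m.+1 (4 * degree_ratio)) => // n /=; rewrite geq_max => /andP[mn n_ge] n_even.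
have n0 : 0 < n%:R :> R by rewrite ltr0n; lia.
have p_ge := property_prob n_even n_ge; have p_le := prob_le1 (gadget_distribution c) (@gadget_property R c n).
rewrite ger0_norm ?subr_ge0 //.
have : a%:R / n%:R < e.
  rewrite ltr_pdivrMr // mulrC -ltr_pdivrMr //; apply: lt_le_trans m_gt _.
  by rewrite ler_nat; lia.
by rewrite -/a in p_ge; lra.
Qed.

End Limits.

Lemma sos_feasible_leq (R : realType) n (d d' : nat) (E : {mpoly R[n]} -> R) :
  (d <= d')%N -> sos_feasible d' E -> sos_feasible d E.
Proof.
move=> dd' [[lin E1 sq pos] bis]; split=> //; split=> //.
- by move=> a p q pd qd; apply: lin; apply: leq_trans dd'.
- by move=> v q qd; apply: sq; apply: leq_trans dd'.
- by move=> q qd; apply: pos; apply: leq_trans dd'.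
Qed.

Lemma not_sos_delivers (R : realType) n (d d' : nat) (alpha beta gamma : R)
    (G : instance n) E : (d <= d')%N -> 0 <= alpha -> 0 <= gamma ->
  sos_solution d' G beta E ->
  (forall S : {set 'I_n}, bisection S -> cut_fraction R G S <= gamma) ->
  gamma < alpha * beta -> ~ sos_delivers_factor n d alpha.
Proof.
move=> dd' alpha0 gamma0 [feas [Ebeta _]] cut_le lt_gamma /(_ G).
have opt_ge : (beta%:E <= sos_opt R d G)%E.
  apply: ereal_sup_ubound; exists E; first exact: sos_feasible_leq feas.
  by rewrite Ebeta.
have bis_le : maxbis_opt R G <= gamma by apply: bigmax_le.
have : (alpha%:E * beta%:E <= alpha%:E * sos_opt R d G)%E.
  by apply: lee_wpmul2l => //; rewrite lee_fin.
move=> /le_trans h /h; rewrite -EFinM lee_fin => le_bis.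
by have := lt_le_trans lt_gamma (le_trans le_bis bis_le); rewrite ltxx.
Qed.

Local Open Scope classical_set_scope.
Local Open Scope ring_scope.

Theorem theorem12 (R : realType) (eps : R) (c : nat) (c_gt0 : (0 < c)%N)
    (c_even : ~~ odd c) (eps_def : eps = 1 / (4 * c)%:R) :
  (exists (D : instance_distribution) (d : nat -> nat),
    [/\ efficiently_samplable D,
        big_Omega_n R d
      & with_high_probability R D (fun n (G : instance n) =>
          (exists E : {mpoly R[n]} -> R,
             sos_solution (d n) G (3%:R / 4%:R - eps) E)
          /\ (forall S : {set 'I_n}, bisection S ->
                cut_fraction R G S <= 11%:R / 16%:R + eps))])
  /\ (forall d : nat -> nat, little_o_n R d ->
        \forall n \near \oo, ~~ odd n ->
          ~ sos_delivers_factor n (d n) (11%:R / 12%:R + eps)).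
Proof.
split.
  exists (gadget_distribution c), (sos_degree c); rewrite eps_def.
  split; [exact: gadget_samplable | exact: degree_big_Omega | exact: property_whp].
move=> d d_small; pose c' := (4 * c)%N.
have c'_gt0 : (0 < c')%N by rewrite /c'; lia.
have ratio_gt0 := degree_ratio_gt0 c'_gt0.
have r0 : 0 < (degree_ratio c')%:R :> R by rewrite ltr0n.
pose a := (4 * block_size c' * (expansion_constant c').+1)%N.
have r0V : 0 < (degree_ratio c')%:R^-1 :> R by rewrite invr_gt0.
have /cvgr0Pnorm_lt /(_ _ r0V) [m _ d_lt] := d_small; exists (maxn m (maxn a.+1 (4 * degree_ratio c'))) => // n /=.
rewrite !geq_max => /and3P[mn an n_ge] n_even.
have n0 : 0 < n%:R :> R by rewrite ltr0n; lia.
have /andP[_ n_le] := degree_lower c'_gt0 n_ge.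
have dd' : (d n <= sos_degree c' n)%N.
  have := d_lt n mn; rewrite ger0_norm ?divr_ge0 // ltr_pdivrMr // mulrC ltr_pdivlMr //.
  rewrite -natrM ltr_nat => lt_n; rewrite -(leq_pmul2l ratio_gt0) mulnC.
  by apply: leq_trans n_le; exact: ltnW.
have [r [[E solE] cutG]] : exists r : (coins (gadget_distribution c') n).-tuple bool,
    gadget_property R c' (draw r).
  apply: contrapT => /forallNP none.
  have := property_prob R c'_gt0 n_even n_ge; rewrite -/a /prob (_ : #|_| = 0%N).
    rewrite mul0r subr_le0 ler_pdivlMr // mul1r ler_nat; lia.
  by apply: eq_card0 => r; rewrite !inE; apply/asboolP/none.
apply: (not_sos_delivers dd' _ _ solE cutG); rewrite ?eps_def /c'.
- by rewrite addr_ge0 // divr_ge0.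
- by rewrite addr_ge0 // divr_ge0.
have c1 : 1 <= c%:R :> R by rewrite ler1n.
rewrite !natrM; have c0 : 0 < c%:R^-1 :> R by rewrite invr_gt0; lra.
have cV1 : c%:R^-1 <= 1 :> R by rewrite invf_le1 //; lra.
rewrite !mul1r !invfM; move: (c%:R^-1) c0 cV1 => z z0 z1; nra.
Qed.
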